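(* Let $(\mathbf X,Y)$ be an $\mathbb R^d\times\mathbb R$-valued random pair such that $\mathbf X$ has a probability density with respect to Lebesgue measure on $\mathbb R^d$ and $Y$ is bounded, let $\mu$ be the distribution of $\mathbf X$, and assume that the regression function $r(\mathbf x)=\mathbb E[Y\mid \mathbf X=\mathbf x]$ is $\mu$-almost surely continuous (i.e. $r$ is continuous at $\mu$-almost every point of $\mathbb R^d$). Let $r_n$ be the $k_n$-nearest neighbor regression estimate based on the empirical distance $\rho_n$ and the sample $(\mathbf X_1,Y_1),\dots,(\mathbf X_n,Y_n)$. Then, for $\mu$-almost all $\mathbf x\in\mathbb R^d$ and all $p\ge 1$, if $k_n\to\infty$ and $k_n/n\to 0$ as $n\to\infty$, $$\mathbb E\left|r_n(\mathbf x)-r(\mathbf x)\right|^p\to 0\quad\text{as } n\to\infty.$$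
   Context: Data: $(\mathbf X_1,Y_1),(\mathbf X_2,Y_2),\dots$ are i.i.d. $\mathbb R^d\times\mathbb R$-valued random pairs, independent of and with the same distribution as $(\mathbf X,Y)$; $n\ge d$ throughout. The $k_n$ are integers with $1\le k_n\le n$. Hyperplanes: since $\mathbf X$ has a density, with probability 1 any $d$ points $\mathbf X_{i_1},\dots,\mathbf X_{i_d}$ ($1\le i_1<\dots<i_d\le n$) lie on a unique hyperplane of $\mathbb R^d$, denoted $\mathcal H(\mathbf X_{i_1},\dots,\mathbf X_{i_d})$. Empirical distance: for $\mathbf x,\mathbf x'\in\mathbb R^d$, $$\rho_n(\mathbf x,\mathbf x')=\sum_{1\le i_1<\dots<i_d\le n}\mathbf 1_{\{\text{segment }(\mathbf x,\mathbf x')\text{ intersects the hyperplane }\mathcal H(\mathbf X_{i_1},\dots,\mathbf X_{i_d})\}},$$ where the segment $(\mathbf x,\mathbf x')$ is the line segment joining $\mathbf x$ and $\mathbf x'$; that is, $\rho_n(\mathbf x,\mathbf x')$ counts the hyperplanes through $d$ of the points $\mathbf X_1,\dots,\mathbf X_n$ that separate $\mathbf x$ and $\mathbf x'$. Estimate: for $\mathbf x\in\mathbb R^d$, let $(\mathbf X_{(1)}(\mathbf x),Y_{(1)}(\mathbf x)),\dots,(\mathbf X_{(n)}(\mathbf x),Y_{(n)}(\mathbf x))$ be the reordering of the data $(\mathbf X_1,Y_1),\dots,(\mathbf X_n,Y_n)$ according to increasing values of $\rho_n(\mathbf x,\mathbf X_i)$, ties being broken by indices (if $\rho_n(\mathbf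 x,\mathbf X_i)=\rho_n(\mathbf x,\mathbf X_j)$ and $i<j$, then $\mathbf X_i$ is declared closer). The estimate is $$r_n(\mathbf x)=\frac1{k_n}\sum_{i=1}^{k_n}Y_{(i)}(\mathbf x).$$ *)

(* Defs.v *)
From HB Require Import structures.
From mathcomp Require Import all_boot all_order all_algebra finmap.
From mathcomp Require Import all_classical all_reals all_analysis.

Set Implicit Arguments.
Unset Strict Implicit.
Unset Printing Implicit Defensive.

Import Order.TTheory GRing.Theory Num.Theory.
Import numFieldNormedType.Exports.

Local Open Scope classical_set_scope.
Local Open Scope ring_scope.

Definition rV_display : measure_display.
Proof. exact: default_measure_display. Qed.

(* 'rV[R]_n carries the sigma-algebra generated by the n coordinates, as the
   library does for n.-tuple R; this is the Borel sigma-algebra of R^n. *)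
Section rV_measurable.
Context (R : realType) (n : nat).

Definition rV_coord (i : 'I_n) (v : 'rV[R]_n) : R := v ord0 i.

Let rV_set0 : g_sigma_preimage rV_coord set0.
Proof. exact: sigma_algebra0. Qed.

Let rV_setC A : g_sigma_preimage rV_coord A -> g_sigma_preimage rV_coord (~` A).
Proof. exact: sigma_algebraC. Qed.

Let rV_bigcup (F : (set 'rV[R]_n)^nat) :
  (forall i, g_sigma_preimage rV_coord (F i)) ->
  g_sigma_preimage rV_coord (\bigcup_i (F i)).
Proof. exact: sigma_algebra_bigcup. Qed.

HB.instance Definition _ := @isMeasurable.Build rV_display 'rV[R]_n
  (g_sigma_preimage rV_coord) rV_set0 rV_setC rV_bigcup.

Lemma measurable_rV_coord (i : 'I_n) : measurable_fun [set: 'rV[R]_n] (rV_coord i).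
Proof.
move=> _ Y mY; rewrite setTI; apply: sub_sigma_algebra => /=.
rewrite -bigcup_seq/=; exists i => /=; first by rewrite mem_index_enum.
by exists Y => //; rewrite setTI.
Qed.

Lemma measurable_fun_rV d (T : measurableType d) (f : T -> 'rV[R]_n) :
  (forall i, measurable_fun [set: T] (rV_coord i \o f)) ->
  measurable_fun [set: T] f.
Proof.
move=> mf _ A mA; rewrite setTI; move: A mA.
pose G : set (set 'rV[R]_n) := [set A | measurable (f @^-1` A)].
suff H : measurable `<=` G by [].
apply: smallest_sub.
  split; rewrite /G/=.
  - by rewrite preimage_set0.
  - by move=> A mA; rewrite setTD -preimage_setC; exact: measurableC.
  - by move=> F mF; rewrite preimage_bigcup; exact: bigcup_measurable.
rewrite -bigcup_seq => _ [i _] [B mB <-]; rewrite /G/= setTI.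
by have := mf i measurableT B mB; rewrite setTI.
Qed.

End rV_measurable.

Section lebesgue_rV.
Context (R : realType).

Definition rV_cons n (p : R * 'rV[R]_n) : 'rV[R]_n.+1 :=
  row_mx (p.1%:M : 'rV_1) p.2.

Lemma rV_cons0 n (p : R * 'rV[R]_n) : rV_cons p ord0 ord0 = p.1.
Proof.
have := row_mxEl (p.1%:M : 'rV_1) p.2 ord0 ord0.
rewrite [X in _ = X -> _]mxE mulr1n => <-.
by rewrite /rV_cons; congr (fun_of_matrix _ _ _); exact: val_inj.
Qed.

Lemma rV_consS n (p : R * 'rV[R]_n) (i : 'I_n) :
  rV_cons p ord0 (lift ord0 i) = p.2 ord0 i.
Proof.
have := row_mxEr (p.1%:M : 'rV_1) p.2 ord0 i => <-.
by rewrite /rV_cons; congr (fun_of_matrix _ _ _); exact: val_inj.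
Qed.

Lemma measurable_rV_cons n : measurable_fun [set: R * 'rV[R]_n] (@rV_cons n).
Proof.
apply: measurable_fun_rV => i; have [j ->|->] := unliftP ord0 i.
  have -> : rV_coord (lift ord0 j) \o @rV_cons n = rV_coord j \o snd.
    by apply/funext => p; exact: rV_consS.
  by apply: measurableT_comp => //; exact: measurable_rV_coord.
have -> : rV_coord ord0 \o @rV_cons n = fst.
  by apply/funext => p; exact: rV_cons0.
exact: measurable_fst.
Qed.

Section step.
Context (n : nat) (m : {sigma_finite_measure set 'rV[R]_n -> \bar R}).

Definition lebesgue_rV_step : set 'rV[R]_n.+1 -> \bar R :=
  pushforward (lebesgue_measure \x m)%E (@rV_cons n).


Let mpre (A : set 'rV[R]_n.+1) : measurable A -> measurable (@rV_cons n @^-1` A).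
Proof. by move=> mA; rewrite -[X in measurable X]setTI; exact: measurable_rV_cons. Qed.

Let step0 : lebesgue_rV_step set0 = 0%E.
Proof. by rewrite /lebesgue_rV_step /pushforward preimage_set0 measure0. Qed.

Let step_ge0 A : (0 <= lebesgue_rV_step A)%E.
Proof. by rewrite /lebesgue_rV_step /pushforward. Qed.

Let step_sigma_additive : semi_sigma_additive lebesgue_rV_step.
Proof.
move=> F mF tF mUF; rewrite /lebesgue_rV_step /pushforward preimage_bigcup.
apply: measure_semi_sigma_additive.
- by move=> i; exact: mpre.
- apply/trivIsetP => /= i j _ _ ij; rewrite -preimage_setI.
  by move/trivIsetP : tF => /(_ _ _ _ _ ij) ->//; rewrite preimage_set0.
- by rewrite -preimage_bigcup; exact: mpre.
Qed.

HB.instance Definition _ := isMeasure.Build _ _ _ lebesgue_rV_step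
  step0 step_ge0 step_sigma_additive.

Lemma lebesgue_rV_stepE (A : set R) (B : set 'rV[R]_n) :
  measurable A -> measurable B ->
  lebesgue_rV_step [set v | A (v ord0 ord0) /\
                            B (\row_(i < n) v ord0 (lift ord0 i))]
  = (lebesgue_measure A * m B)%E.
Proof.
move=> mA mB; rewrite /lebesgue_rV_step /pushforward.
rewrite -(product_measure1E lebesgue_measure m mA mB); congr product_measure1.
apply/seteqP; split=> -[x v] /=; rewrite rV_cons0;
  (have -> : \row_i rV_cons (x, v) ord0 (lift ord0 i) = v
    by apply/rowP => i; rewrite mxE rV_consS); by [].
Qed.

Let mhead : measurable_fun [set: 'rV[R]_n.+1] (fun v : 'rV[R]_n.+1 => v ord0 ord0).
Proof. exact: (measurable_rV_coord ord0). Qed.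

Let mtail : measurable_fun [set: 'rV[R]_n.+1]
  (fun v : 'rV[R]_n.+1 => \row_(i < n) v ord0 (lift ord0 i)).
Proof.
apply: measurable_fun_rV => i; rewrite (_ : _ \o _ = rV_coord (lift ord0 i)).
  exact: measurable_rV_coord.
by apply/funext => v; rewrite /rV_coord/= mxE.
Qed.

Let step_sigma_finite : sigma_finite setT lebesgue_rV_step.
Proof.
have /sigma_finiteP[F [TF ndF Foo]] := sigma_finiteT (@lebesgue_measure R).
have /sigma_finiteP[G [TG ndG Goo]] := sigma_finiteT m.
exists (fun k => [set v : 'rV[R]_n.+1 | F k (v ord0 ord0) /\
                          G k (\row_(i < n) v ord0 (lift ord0 i))]).
  apply/seteqP; split=> // v _.
  have : [set: R] (v ord0 ord0) by [].
  rewrite TF => -[i _ Fi].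
  have : [set: 'rV[R]_n] (\row_(i < n) v ord0 (lift ord0 i)) by [].
  rewrite TG => -[j _ Gj].
  exists (maxn i j) => //; split.
    by move: Fi; exact/subsetPset/ndF/leq_maxl.
  by move: Gj; exact/subsetPset/ndG/leq_maxr.
move=> k; have [mF Fk] := Foo k; have [mG Gk] := Goo k; split.
  apply: measurableI.
    by rewrite -[X in measurable X]setTI; exact: mhead.
  by rewrite -[X in measurable X]setTI; exact: mtail.
by rewrite lebesgue_rV_stepE// lte_mul_pinfty// ge0_fin_numE.
Qed.

HB.instance Definition _ := Measure_isSigmaFinite.Build _ _ _ lebesgue_rV_step
  step_sigma_finite.

End step.

(* Lebesgue measure on R^n as an iterated product of the measure on R. *)
Fixpoint lebesgue_rV n : {sigma_finite_measure set 'rV[R]_n -> \bar R} :=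
  if n is n'.+1 return {sigma_finite_measure set 'rV[R]_n -> \bar R}
  then lebesgue_rV_step (lebesgue_rV n') else \d_(0 : 'rV[R]_0).

Lemma lebesgue_rV_box n (a b : 'I_n -> R) : (forall i, a i <= b i) ->
  lebesgue_rV n [set v | forall i, a i <= v ord0 i <= b i] =
  (\prod_(i < n) (b i - a i))%:E.
Proof.
elim: n a b => [|n IHn] a b ab.
  rewrite big_ord0 /= diracE mem_set// => i; by have := ltn_ord i.
have box_meas : measurable [set v : 'rV[R]_n | forall i,
    a (lift ord0 i) <= v ord0 i <= b (lift ord0 i)].
  rewrite [X in measurable X](_ : _ = \bigcap_(i in [set: 'I_n])
      (rV_coord i @^-1` `[a (lift ord0 i), b (lift ord0 i)])); last first.
    by apply/seteqP; split=> v /= H i; have := H i; rewrite /= in_itv//= => /(_ I).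
  apply: fin_bigcap_measurable => // i _; rewrite -[X in measurable X]setTI.
  by apply: measurable_rV_coord => //; exact: measurable_itv.
rewrite big_ord_recl /= EFinM -(IHn (a \o lift ord0) (b \o lift ord0)); last first.
  by move=> i; exact: ab.
have -> : ((b ord0 - a ord0)%:E = lebesgue_measure (`[a ord0, b ord0] : set R))%E.
  by rewrite lebesgue_measure_itv/= lte_fin lt_neqAle ab andbT; case: eqVneq => [->|//]; rewrite subrr.
rewrite -lebesgue_rV_stepE//; congr (lebesgue_rV_step _ _).
apply/seteqP; split=> v /=.
  move=> H; split; first by rewrite in_itv/=; exact: H.
  by move=> i; rewrite mxE; exact: H.
rewrite in_itv/= => -[H0 H] i; have [j ->|-> //] := unliftP ord0 i.
by have := H j; rewrite mxE.
Qed.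

End lebesgue_rV.

Section probability.
Context d (Omega : measurableType d) (R : realType) (P : probability Omega R).

(* Mutual independence of a family of T-valued random elements: the product
   rule over every finite subfamily. *)
Definition mutually_independent d' (T : measurableType d') (I : choiceType)
    (Z : I -> Omega -> T) :=
  forall (J : {fset I}) (B : I -> set T), (forall i, measurable (B i)) ->
    P (\bigcap_(i in [set` J]) (Z i @^-1` B i)) =
    (\prod_(i <- J) P (Z i @^-1` B i))%E.

Definition identically_distributed d' (T : measurableType d')
    (Z W : Omega -> T) :=
  forall B : set T, measurable B -> P (Z @^-1` B) = P (W @^-1` B).

Definition has_density n (X : {RV P >-> 'rV[R]_n}) :=
  exists f : 'rV[R]_n -> R,
    [/\ measurable_fun setT f, (forall x, 0 <= f x) &
        forall B, measurable B ->
          distribution P X B = (\int[lebesgue_rV R n]_(x in B) (f x)%:E)%E].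

(* r is a version of x |-> E[Y | X = x]. *)
Definition regression_function d' (T : measurableType d')
    (X : {RV P >-> T}) (Y : {RV P >-> R}) (r : T -> R) :=
  [/\ measurable_fun setT r,
      (distribution P X).-integrable setT (EFin \o r) &
      forall B, measurable B ->
        (\int[distribution P X]_(x in B) (r x)%:E =
         \int[P]_(w in X @^-1` B) (Y w)%:E)%E].

End probability.

Section empirical_distance.
Context (R : realType) (d : nat).

Definition is_hyperplane (H : set 'rV[R]_d) :=
  exists (u : 'rV[R]_d) (c : R),
    u != 0 /\ H = [set z | \sum_(j < d) u ord0 j * z ord0 j = c].

(* When exactly one hyperplane contains A, this is that hyperplane. Otherwise
   (a null event for d sample points drawn from a density) it is the
   intersection of all the hyperplanes containing A. *)
Definition hyperplane_through (A : set 'rV[R]_d) : set 'rV[R]_d :=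
  \bigcap_(H in [set H | is_hyperplane H /\ A `<=` H]) H.

(* The segment is closed: both endpoints are included. *)
Definition segment (x x' : 'rV[R]_d) : set 'rV[R]_d :=
  [set (1 - t) *: x + t *: x' | t in [set t : R | 0 <= t <= 1]].

(* The index sets i_1 < ... < i_d are the d-element subsets S of 'I_n. *)
Definition empirical_distance n (pts : 'I_n -> 'rV[R]_d) (x x' : 'rV[R]_d) : nat :=
  (\sum_(S : {set 'I_n} | #|S| == d)
    `[< segment x x' `&` hyperplane_through (pts @` [set` S]) !=set0 >])%N.

Definition closer n (pts : 'I_n -> 'rV[R]_d) (x : 'rV[R]_d) : rel 'I_n :=
  fun i j =>
    let rho := fun i => empirical_distance pts x (pts i) in
    ((rho i < rho j) || ((rho i == rho j) && (i <= j)))%N.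

Definition nn_order n (pts : 'I_n -> 'rV[R]_d) (x : 'rV[R]_d) : seq 'I_n :=
  sort (closer pts x) (enum 'I_n).

Definition nn_estimate n (k : nat) (pts : 'I_n -> 'rV[R]_d) (y : 'I_n -> R)
    (x : 'rV[R]_d) : R :=
  k%:R^-1 * \sum_(i <- take k (nn_order pts x)) y i.

End empirical_distance.

(* Main.v *)
Require Import Defs.
From HB Require Import structures.
From mathcomp Require Import finmap.
From mathcomp Require Import all_boot all_order all_algebra.
From mathcomp Require Import all_classical all_reals all_analysis.
From mathcomp Require Import measurable_realfun.
From mathcomp Require Import ring lra zify.

Set Implicit Arguments.
Unset Strict Implicit.
Unset Printing Implicit Defensive.

Import Order.TTheory GRing.Theory Num.Theory.
Import numFieldNormedType.Exports.

Local Open Scope classical_set_scope.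
Local Open Scope ring_scope.

(** Write u_S for the vector such that the hyperplane through the d sample points
   indexed by S is the set of the z with (z - x) . u_S = 1. It exists as soon as
   that hyperplane avoids x, which happens almost surely
   ([negligible_degenerate]), and S then separates x from y exactly when
   (y - x) . u_S >= 1 ([segment_meets_hyperplane]). So empirical distances to x
   are counts of explicit measurable events.

   The nearest neighbours are close to x. At almost every x, each of d + 1 narrow
   cones with apex x, around e_1, ..., e_d and -(1, ..., 1), has positive mass
   arbitrarily close to x ([ae_mass_along_direction]). One sample point in each
   cone, all of them near x, makes a simplex around x, and one of its facets
   separates x from any far point ([facing_cones_separate]). By the law of large
   numbers every cone receives a positive fraction of the sample, so all far
   sample points are at empirical distance at least c n^d ([far_point_count]). On
   the other hand, if S separates x from some point at distance at most eta, then
   the l1 norm of u_S is at least 1 / eta. This event does not depend on the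
   point, its probability q(eta) is the same for all S, and q(eta) tends to 0 with
   eta. By Markov's inequality, with high probability all the sample points within
   eta of x are at empirical distance less than c n^d. There are more than k_n of
   them, because k_n / n tends to 0; hence the k_n nearest neighbours are not far
   ([neighbours_are_close]).

   The noise averages out. The choice of the neighbours depends on the X_i only.
   Given these, the noises Y_i - r(X_i) are centred and independent, so the
   selected noises are orthogonal and the second moment of their average is
   O(1 / k_n) ([selected_noise_small]).

   Off an event of small probability the estimate therefore differs from r(x) by a
   small noise plus the oscillation of r near x
   ([error_small_with_high_probability]). Since the estimate is bounded,
   convergence in probability gives convergence of all moments. The estimate
   agrees with a measurable function off a null set, which is enough for the upper
   bound on its integral ([integral_le_exceptional]). *)

(** * Translation invariance of Lebesgue measure *)

Lemma lebesgue_measure_translate (R : realType) (t : R) (A : set R) :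
  measurable A ->
  lebesgue_measure ((fun x => x + t) @^-1` A) = lebesgue_measure A.
Proof.
move=> mA; apply/esym.
have mt : measurable_fun [set: measurableTypeR R]
    (fun x : measurableTypeR R => x + t : measurableTypeR R).
  by apply: measurable_funD => //; exact: measurable_cst.
pose mu : {measure set (measurableTypeR R) -> \bar R} :=
  measure_function_pushforward__canonical__measure_function_Measure lebesgue_measure mt.
apply: (lebesgue_measure_unique (mu := mu)) => // X [[a b] /= _ <-].
rewrite /mu /= /pushforward.
have -> : (fun x => x + t) @^-1` `]a, b] = `](a - t)%R, (b - t)%R]%classic.
  by apply/seteqP; split => x; rewrite /= !in_itv/= ltrBlDr lerBrDr.
rewrite !lebesgue_measure_itv/= !lte_fin; rewrite ltrD2r; case: ifP => // _.
by rewrite -!EFinD; congr (_%:E); ring.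
Qed.

Lemma measurable_rV_translate (R : realType) n (v : 'rV[R]_n) :
  measurable_fun [set: 'rV[R]_n] (fun x => x + v).
Proof.
apply: measurable_fun_rV => i.
rewrite (_ : _ \o _ = fun x => rV_coord i x + v ord0 i); last first.
  by apply/funext => x; rewrite /rV_coord/= mxE.
by apply: measurable_funD; [exact: measurable_rV_coord|exact: measurable_cst].
Qed.

Lemma measurable_preimage_fun d1 d2 (T1 : measurableType d1)
    (T2 : measurableType d2) (f : T1 -> T2) (A : set T2) :
  measurable_fun [set: T1] f -> measurable A -> measurable (f @^-1` A).
Proof. by move=> mf mA; rewrite -[X in measurable X]setTI; exact: mf. Qed.

Lemma lebesgue_rV_translate (R : realType) n (v : 'rV[R]_n) A :
  measurable A -> lebesgue_rV R n ((fun x => x + v) @^-1` A) = lebesgue_rV R n A.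
Proof.
elim: n => [|n IHn] in v A *.
  move=> _; congr (_ _); apply/seteqP; split => x /=;
  by rewrite [v]thinmx0 addr0.
move=> mA /=; rewrite /lebesgue_rV_step /pushforward.
set m := lebesgue_rV R n.
pose v' : 'rV[R]_n := \row_i v ord0 (lift ord0 i).
pose T := (measurableTypeR R * 'rV[R]_n)%type.
pose f (p : T) : T := (p.1 + v ord0 ord0 : R, p.2 + v').
have mf : measurable_fun [set: T] f.
  apply/measurable_fun_pairP; split.
    rewrite (_ : _ \o _ = fun p => p.1 + v ord0 ord0)//.
    by apply: measurable_funD => //; exact: measurable_cst.
  rewrite (_ : _ \o _ = (fun x => x + v') \o snd)//.
  by apply: measurableT_comp => //; exact: measurable_rV_translate.
pose mu : {measure set T -> \bar R} :=
  measure_function_pushforward__canonical__measure_function_Measure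
    (lebesgue_measure \x m)%E mf.
have -> : (@rV_cons R n) @^-1` ((fun x => x + v) @^-1` A) =
    f @^-1` ((@rV_cons R n) @^-1` A).
  have vE (p : R * 'rV[R]_n) : rV_cons p + v = rV_cons (f p).
    apply/rowP => i; rewrite [LHS]mxE; have [j ->|->] := unliftP ord0 i.
      by rewrite !rV_consS /f/= !mxE.
    by rewrite !rV_cons0.
  by apply/seteqP; split => p /=; rewrite vE.
rewrite [RHS](@product_measure_unique _ _ _ _ _ lebesgue_measure m mu)//.
  move=> B C mB mC; rewrite /mu /= /pushforward.
  rewrite (_ : f @^-1` _ = ((fun x => x + v ord0 ord0) @^-1` B) `*`
      ((fun x => x + v') @^-1` C))//.
  rewrite product_measure1E ?IHn//.
  - by congr (_ * _)%E; exact: lebesgue_measure_translate.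
  - apply: (@measurable_preimage_fun _ _ (measurableTypeR R) (measurableTypeR R)) => //.
    by apply: measurable_funD => //; exact: measurable_cst.
  - by apply: measurable_preimage_fun => //; exact: measurable_rV_translate.
by apply: measurable_preimage_fun => //; exact: measurable_rV_cons.
Qed.

(** * Null sets *)

Lemma measurable_rV_box (R : realType) n (a b : 'I_n -> R) :
  measurable [set v : 'rV[R]_n | forall i, a i <= v ord0 i <= b i].
Proof.
rewrite [X in measurable X](_ : _ = \bigcap_(i in [set: 'I_n])
    (rV_coord i @^-1` `[a i, b i])); last first.
  by apply/seteqP; split=> v /= H i; have := H i; rewrite /= in_itv//= => /(_ I).
apply: fin_bigcap_measurable => // i _; apply: measurable_preimage_fun.
  exact: measurable_rV_coord.
exact: measurable_itv.
Qed.

(** Infinitely many disjoint translates of a set of positive measure do not fit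
   into a box. *)
Lemma lebesgue_rV_null_of_disjoint_translates (R : realType) n
    (K : set 'rV[R]_n) (e : 'rV[R]_n) (delta : R) :
  measurable K -> 0 < delta ->
  (forall t x, 0 < t < delta -> K x -> ~ K (x + t *: e)) ->
  lebesgue_rV R n K = 0%E.
Proof.
move=> mK delta0 Ktrans.
pose B (c : R) := [set v : 'rV[R]_n | forall i, - c <= v ord0 i <= c].
have mB c : measurable (B c) by exact: measurable_rV_box.
pose Km m := K `&` B m%:R.
have mKm m : measurable (Km m) by exact: measurableI.
suff Km0 m : lebesgue_rV R n (Km m) = 0%E.
  have KE : K = \bigcup_m Km m.
    apply/seteqP; split => [v Kv|v [m _ []]//].
    pose c : R := \sum_i `|v ord0 i|.
    exists (Num.trunc c).+1 => //; split => // i.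
    rewrite -ler_norml; apply: (@le_trans _ _ c).
      by rewrite /c (bigD1 i)//= lerDl sumr_ge0.
    by apply/ltW; exact: truncnS_gt.
  have : (lebesgue_rV R n).-negligible K.
    rewrite KE; apply: negligible_bigcup => m; by apply/negligibleP => //; exact: Km0.
  by move/(negligibleP _ mK).
(* differences of two of these lengths stay in ]0, delta[ *)
pose t j : R := delta / j.+2%:R.
pose F j := (fun x => x + t j *: e) @^-1` (Km m).
have mF j : measurable (F j).
  by apply: measurable_preimage_fun => //; exact: measurable_rV_translate.
have t0 j : 0 < t j by rewrite divr_gt0.
have td j : t j < delta by rewrite ltr_pdivrMr// ltr_pMr// ltr1n.
have tF : trivIset setT F.
  suff H i j x : (i < j)%N -> F i x -> F j x -> False.
    apply/trivIsetP => i j _ _ ij; apply/seteqP; split => // x [Fi Fj].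
    by have [/H h|/H h|/eqP] := ltngtP i j;
      [exact: h Fi Fj|exact: h Fj Fi|rewrite (negbTE ij)].
  move=> ij [Ki _] [Kj _]; apply: (Ktrans (t i - t j) (x + t j *: e)).
    have tij : t j < t i by rewrite ltr_pM2l// ltf_pV2 ?posrE// ltr_nat !ltnS.
    by rewrite subr_gt0 tij/= (le_lt_trans _ (td i))// gerBl ltW.
    exact: Kj.
  by rewrite -addrA -scalerDl [t j + _]addrC subrK.
pose c : R := m%:R + delta * \sum_i `|e ord0 i|.
have FB j : F j `<=` B c.
  move=> x [_ xB] i; rewrite -ler_norml; have := xB i; rewrite !mxE -ler_norml.
  have : `|t j * e ord0 i| <= delta * \sum_i `|e ord0 i|.
    rewrite normrM gtr0_norm// ler_pM//; [exact/ltW|exact/ltW|].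
    by rewrite (bigD1 i)//= lerDl sumr_ge0.
  move=> h1 h2; rewrite /c -(addrK (t j * e ord0 i) (x ord0 i)).
  by rewrite (le_trans (ler_normB _ _))// lerD.
have c0 : 0 <= c.
  by apply: addr_ge0 => //; apply: mulr_ge0; [exact: ltW|exact: sumr_ge0].
pose L : R := \prod_(i < n) (c - - c).
have LE : lebesgue_rV R n (B c) = L%:E.
  by rewrite (@lebesgue_rV_box R n (fun=> - c) (fun=> c))// => i; rewrite ge0_cp.
have aN N : (\sum_(i < N) lebesgue_rV R n (Km m) <= L%:E)%E.
  rewrite -LE.
  rewrite (eq_bigr (fun i : 'I_N => lebesgue_rV R n (F i))); last first.
    by move=> i _; rewrite /F lebesgue_rV_translate.
  rewrite -(@measure_bigsetU_ord _ _ _ _ N predT (fun i => F i))//.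
    apply: le_measure; rewrite ?inE//.
      by apply: bigsetU_measurable => i _.
    apply: (big_ind (fun A => A `<=` B c)) => [//|A1 A2 h1 h2|i _].
      by move=> x [/h1|/h2].
    exact: FB.
  by apply/trivIsetP => i j _ _ ij; move/trivIsetP: tF; exact.
have : (0 <= lebesgue_rV R n (Km m))%E by [].
have := aN 1%N; rewrite big_ord1.
case: (lebesgue_rV R n (Km m)) aN => [a| |] //= aN _; rewrite lee_fin => a0.
congr (_%:E).
apply/eqP; rewrite eq_le a0 andbT leNgt; apply/negP => {}a0.
have := aN (Num.trunc (L / a)).+1.
rewrite sumEFin lee_fin sumr_const card_ord -mulr_natl leNgt -ltr_pdivrMr//.
by rewrite truncnS_gt.
Qed.

Lemma negligible_fin_exists d (T : measurableType d) (R : realType)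
    (mu : {measure set T -> \bar R}) (I : finType) (A : I -> set T) :
  (forall i, mu.-negligible (A i)) -> mu.-negligible [set x | exists i, A i x].
Proof.
move=> nA; pose e := index_enum I.
pose F k : set T := nth (set0 : set T) (map A e) k.
have nF k : mu.-negligible (F k).
  rewrite /F; have [kI|kI] := ltnP k (size e); last first.
    by rewrite nth_default; [exact: negligible_set0|rewrite size_map].
  by move: kI; case: (e) => // i0 s kI; rewrite (nth_map i0).
apply: (negligibleS _ (negligible_bigcup nF)) => x [i Ai].
exists (index i e) => //.
by rewrite /F (nth_map i) ?nth_index ?index_mem ?mem_index_enum.
Qed.

Section measurable_comparison.
Context d (T : measurableType d) (R : realType) (f g : T -> R).
Hypotheses (mf : measurable_fun [set: T] f) (mg : measurable_fun [set: T] g).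

Lemma measurable_set_lt : measurable [set x | f x < g x].
Proof.
rewrite -[X in measurable X]setTI.
by have := @measurable_lte _ _ _ _ measurableT (EFin \o f) (EFin \o g); apply;
  exact/measurable_EFinP.
Qed.

Lemma measurable_set_le : measurable [set x | f x <= g x].
Proof.
rewrite -[X in measurable X]setTI.
by have := @measurable_lee _ _ _ _ measurableT (EFin \o f) (EFin \o g); apply;
  exact/measurable_EFinP.
Qed.

End measurable_comparison.

Lemma measurable_fin_forall d (T : measurableType d) (I : finType)
    (A : I -> set T) :
  (forall i, measurable (A i)) -> measurable [set x | forall i, A i x].
Proof.
move=> mA; rewrite [X in measurable X](_ : _ = \bigcap_(i in [set: I]) A i).
  by apply: fin_bigcap_measurable => //; exact: finite_finset.
by apply/seteqP; split=> x h i //; exact: h.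
Qed.

Lemma measurable_fun_dot d (T : measurableType d) (R : realType) n
    (f g : T -> 'rV[R]_n) :
  measurable_fun [set: T] f -> measurable_fun [set: T] g ->
  measurable_fun [set: T] (fun x => \sum_(j < n) f x ord0 j * g x ord0 j).
Proof.
move=> mf mg; apply: measurable_sum => j; apply: measurable_funM.
  by apply: (measurableT_comp (measurable_rV_coord j)).
by apply: (measurableT_comp (measurable_rV_coord j)).
Qed.

Lemma lebesgue_rV_hyperplane (R : realType) n (u : 'rV[R]_n) (c : R) :
  u != 0 -> lebesgue_rV R n [set v | \sum_(j < n) u ord0 j * v ord0 j = c] = 0%E.
Proof.
move=> u0; have [k uk] : exists k, u ord0 k != 0.
  apply/existsP; rewrite -negb_forall; apply: contra u0 => /forallP h.
  by apply/eqP/rowP => i; rewrite mxE; exact/eqP.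
apply: (@lebesgue_rV_null_of_disjoint_translates _ _ _ (delta_mx 0 k) 1) => //.
  rewrite (_ : [set _ | _] =
      (fun v => \sum_(j < n) u ord0 j * v ord0 j) @^-1` [set c])//.
  by apply: measurable_preimage_fun => //; exact: measurable_fun_dot.
move=> t x /andP[t0 _] /= xc; apply/eqP.
rewrite (eq_bigr (fun j => u ord0 j * x ord0 j +
    u ord0 j * (t *: delta_mx 0 k : 'rV[R]_n) ord0 j)); last first.
  by move=> j _; rewrite mxE mulrDr.
rewrite big_split/= xc (bigD1 k)//= [X in _ + (_ + X)]big1 ?addr0.
  by rewrite !mxE !eqxx mulr1 -subr_eq0 [c + _]addrC addrK mulf_neq0// gt_eqF.
by move=> j jk; rewrite !mxE (negbTE jk) andbF !mulr0.
Qed.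

(** * Points seen from every side *)

Definition open_cube (R : realType) n (q : 'rV[R]_n) (e : R) : set 'rV[R]_n :=
  [set y | forall j, `|y ord0 j - q ord0 j| < e].

Lemma measurable_open_cube (R : realType) n (q : 'rV[R]_n) e :
  measurable (open_cube q e).
Proof.
apply: measurable_fin_forall => j; apply: measurable_set_lt => //.
apply: measurableT_comp => //; apply: measurable_funB.
  exact: measurable_rV_coord.
exact: measurable_cst.
Qed.

(** If x + t e belongs to the support of mu, then x + U, which is a neighbourhood
   of x + t e, has positive mass. So the set of the exceptional points of the
   support is disjoint from its small translates along e, hence Lebesgue null. *)
Lemma ae_mass_along_direction (R : realType) n
    (mu : probability 'rV[R]_n R) (U : set 'rV[R]_n) (e : 'rV[R]_n) (delta : R) :
  (forall B, measurable B -> lebesgue_rV R n B = 0%E -> mu B = 0%E) ->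
  measurable U -> 0 < delta ->
  (forall t, 0 < t < delta -> exists2 rho, 0 < rho & open_cube (t *: e) rho `<=` U) ->
  mu.-negligible [set x | mu [set y | U (y - x)] = 0%E].
Proof.
move=> mu_ac mU delta0 segU.
(* N is the complement of the support: the union of the null rational cubes *)
pose F k : set 'rV[R]_n :=
  if (choice.unpickle k : option ('rV[rat]_n * nat)) is Some (q, m) then
    let B := open_cube (map_mx ratr q) m.+1%:R^-1 in
    if mu B == 0%E then B else set0
  else set0.
have mF k : measurable (F k).
  rewrite /F; case: choice.unpickle => [[q m]|] //; case: ifP => // _.
  exact: measurable_open_cube.
have F0 k : mu (F k) = 0%E.
  rewrite /F; case: choice.unpickle => [[q m]|]; last by rewrite measure0.
  by case: ifP => [/eqP//|_]; rewrite measure0.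
pose N := \bigcup_k F k.
have mN : measurable N by exact: bigcupT_measurable.
have negN : mu.-negligible N.
  by apply: negligible_bigcup => k; exact/(negligibleP _ (mF k))/F0.
pose K := [set x | mu [set y | U (y - x)] = 0%E] `&` ~` N.
have mdiff : measurable_fun [set: 'rV[R]_n * 'rV[R]_n] (fun p => p.2 - p.1).
  apply: measurable_fun_rV => i.
  rewrite (_ : _ \o _ = fun p => rV_coord i p.2 - rV_coord i p.1); last first.
    by apply/funext => p; rewrite /rV_coord/= !mxE.
  by apply: measurable_funB; apply: measurableT_comp => //;
    exact: measurable_rV_coord.
have mK : measurable K.
  apply: measurableI; last exact: measurableC.
  pose A := (fun p : 'rV[R]_n * 'rV[R]_n => p.2 - p.1) @^-1` U.
  have mA : measurable A by exact: measurable_preimage_fun.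
  rewrite (_ : [set _ | _] = (mu \o xsection A) @^-1` [set 0%E]).
    apply: measurable_preimage_fun => //; exact: measurable_fun_xsection.
  by apply/seteqP; split => x /=; congr (mu _ = _);
    apply/seteqP; split => y; rewrite /xsection/= inE.
have negK : mu.-negligible K.
  apply/(negligibleP _ mK)/mu_ac => //.
  apply: (lebesgue_rV_null_of_disjoint_translates (e := e) mK delta0).
  move=> t x tdelta [xU0 _] [_]; apply.
  have [rho rho0 rhoU] := segU t tdelta.
  set x' := x + t *: e.
  pose m := Num.trunc (2 / rho).
  have m0 : 0 < m.+1%:R^-1 :> R by rewrite invr_gt0.
  have /(_ _)/cid-/all_tag[q qP] : forall j, exists r : rat,
      `|x' ord0 j - ratr r| < m.+1%:R^-1.
    move=> j; have [|r] := @rat_in_itvoo R (x' ord0 j - m.+1%:R^-1) (x' ord0 j).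
      by rewrite gtrBl.
    rewrite in_itv/= => /andP[h1 h2]; exists r.
    by rewrite gtr0_norm ?subr_gt0// ltrBlDr -ltrBlDl.
  exists (choice.pickle (\row_j q j, m)) => //; rewrite /F choice.pickleK.
  set B := open_cube _ _.
  have Bx' : B x' by move=> j; rewrite [map_mx _ _ _ _]mxE [X in ratr X]mxE.
  suff -> : mu B == 0%E by [].
  rewrite eq_le measure_ge0 andbT -xU0; apply: le_measure; rewrite ?inE.
  - exact: measurable_open_cube.
  - apply: measurable_preimage_fun => //; exact: measurable_rV_translate.
  - move=> y By; apply: rhoU => j.
    have -> : (y - x) ord0 j - (t *: e) ord0 j = (y ord0 j - x' ord0 j).
      by rewrite !mxE; ring.
    have := By j; have := Bx' j; rewrite !mxE => h1 h2.
    have : 2 * m.+1%:R^-1 < rho.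
      by rewrite ltr_pdivrMr// mulrC -ltr_pdivrMr// truncnS_gt.
    move: h1 h2; rewrite !ltr_norml; move: (m.+1%:R^-1) (ratr _) => a b.
    by move=> /andP[? ?] /andP[? ?] ?; apply/andP; split; lra.
apply: (negligibleS _ (negligibleU negK negN)) => x /= x0.
by have [Nx|Nx] := pselect (N x); [right|left].
Qed.

(** * Simplices around a point *)

Section simplex.
Context (R : realType) (d : nat).
Implicit Types (p : 'I_d.+1 -> 'rV[R]_d) (y u : 'rV[R]_d).

(** Starting from any expression of y, subtract the largest multiple of the
   positive relation that keeps the coefficients nonnegative. *)
Lemma conic_combination_on_facet p (a b : 'I_d.+1 -> R) y :
  (forall i, 0 < a i) -> \sum_i a i *: p i = 0 -> y = \sum_i b i *: p i ->
  exists l (c : 'I_d.+1 -> R),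
    [/\ forall i, 0 <= c i, c l = 0 & y = \sum_i c i *: p i].
Proof.
move=> a0 ap yb.
pose l := [arg min_(i < ord0) (b i / a i)%R]%O.
exists l, (fun i => b i - b l / a l * a i); split.
- move=> i; rewrite subr_ge0 -ler_pdivlMr//.
  by rewrite /l; case: arg_minP => // j _; exact.
- by rewrite divfK ?subrr// gt_eqF.
- rewrite (eq_bigr (fun i => b i *: p i - (b l / a l) *: (a i *: p i))).
    by rewrite sumrB -yb -scaler_sumr ap scaler0 subr0.
  by move=> i _; rewrite scalerBl scalerA.
Qed.

(** If the nonnegative coefficients of y summed to less than 1, then y would be
   as close to the origin as the p i. So y is on the far side of the hyperplane
   dot _ u = 1 that contains all the p i but one. *)
Lemma far_point_beyond_facet p (a b : 'I_d.+1 -> R) (delta : R) y (j0 : 'I_d) :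
  (forall i, 0 < a i) -> \sum_i a i *: p i = 0 -> y = \sum_i b i *: p i ->
  (forall i j, `|p i ord0 j| <= delta) -> delta < `|y ord0 j0| ->
  exists l, forall u,
    (forall i, i != l -> \sum_j p i ord0 j * u ord0 j = 1) ->
    1 <= \sum_j y ord0 j * u ord0 j.
Proof.
move=> a0 ap yb pdelta ydelta.
have [l [c [c0 cl yc]]] := conic_combination_on_facet a0 ap yb.
exists l => u pu.
have -> : \sum_j y ord0 j * u ord0 j = \sum_i c i.
  rewrite yc (eq_bigr (fun j => \sum_i c i * (p i ord0 j * u ord0 j))).
    rewrite exchange_big/=; apply: eq_bigr => i _; rewrite -mulr_sumr.
    by have [->|il] := eqVneq i l; rewrite ?cl ?mul0r// pu// mulr1.
  move=> j _; rewrite summxE mulr_suml; apply: eq_bigr => i _.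
  by rewrite mxE mulrA.
rewrite leNgt; apply/negP => c1; move: ydelta; apply/negP; rewrite -leNgt.
rewrite yc summxE; apply: (le_trans (ler_norm_sum _ _ _)).
have delta0 : 0 <= delta by apply: le_trans (pdelta ord0 j0).
apply: (@le_trans _ _ ((\sum_i c i) * delta)); last first.
  by rewrite ler_piMl// ltW.
rewrite mulr_suml; apply: ler_sum => i _; rewrite mxE normrM ger0_norm//.
by rewrite ler_wpM2l.
Qed.

Section perturbation.
Context (E : 'M[R]_d) (kappa : R).
Hypotheses (Ekappa : forall i j, `|E i j| <= kappa) (dkappa : 4 * d%:R * kappa <= 1).

Let norm_mulE (v : 'rV[R]_d) j :
  `|(v *m E) ord0 j| <= kappa * \sum_i `|v ord0 i|.
Proof.
rewrite mxE (le_trans (ler_norm_sum _ _ _))// mulr_sumr ler_sum// => i _.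
by rewrite normrM mulrC ler_wpM2r.
Qed.

Let sum_kappa (N : R) : 0 <= N -> \sum_(j < d) kappa * N <= N / 4.
Proof.
move=> N0; rewrite sumr_const card_ord -mulr_natl.
have := mulr_ge0 N0 (_ : 0 <= 1 - 4 * d%:R * kappa); rewrite subr_ge0 => /(_ dkappa).
by lra.
Qed.

(** A left kernel vector v satisfies v = - v E, which divides its l1 norm by
   4. *)
Lemma perturbed_identity_unitmx : 1%:M + E \in unitmx.
Proof.
rewrite -row_free_unit; apply: inj_row_free => v.
rewrite mulmxDr mulmx1 => /(canRL (addrK _)); rewrite sub0r => vE.
pose N : R := \sum_j `|v ord0 j|.
have N0 : 0 <= N by exact: sumr_ge0.
have : N <= N / 4.
  apply: le_trans (sum_kappa N0); apply: ler_sum => j _.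
  have -> : v ord0 j = - (v *m E) ord0 j by rewrite [in LHS]vE [LHS]mxE.
  by rewrite normrN; exact: norm_mulE.
move=> NN; have N0' : N = 0 by apply/eqP; rewrite eq_le N0 andbT; clear vE; lra.
 apply/rowP => j; rewrite mxE; apply/eqP; rewrite -normr_eq0.
move/eqP: N0'; rewrite psumr_eq0// => /allP /(_ j).
by rewrite mem_index_enum => /(_ isT).
Qed.

(** The l1 norm of a is at most 5 d / 3, so a is within kappa * (5 d / 3) <= 5 / 12
   of q, which is itself within 1 / 4 of the vector (1, ..., 1). *)
Lemma perturbed_identity_positive_solution (q a : 'rV[R]_d) :
  kappa <= 4^-1 -> (forall j, `|q ord0 j - 1| <= kappa) ->
  a *m (1%:M + E) = q -> forall j, 0 < a ord0 j.
Proof.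
move=> kappa4 qkappa; rewrite mulmxDr mulmx1 => aE j.
pose N : R := \sum_i `|a ord0 i|.
have N0 : 0 <= N by exact: sumr_ge0.
have aq i : `|a ord0 i - q ord0 i| <= kappa * N.
  by rewrite -aE [X in _ - X]mxE opprD addNKr normrN; exact: norm_mulE.
have qi i : `|q ord0 i| <= 1 + kappa.
  have := ler_normD (q ord0 i - 1) 1; rewrite subrK normr1 => /le_trans; apply.
  by rewrite [leRHS]addrC lerD2r.
have NN : N <= d%:R * (1 + kappa) + N / 4.
  apply: (@le_trans _ _ (\sum_(i < d) (1 + kappa + kappa * N))).
    apply: ler_sum => i _; have := ler_normD (a ord0 i - q ord0 i) (q ord0 i).
    by rewrite subrK => /le_trans; apply; rewrite [leRHS]addrC lerD.
  rewrite big_split/=; apply: lerD; last exact: sum_kappa.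
  by rewrite sumr_const card_ord mulr_natl.
have k0 : 0 <= kappa by apply: le_trans (qkappa j).
have : kappa * N <= 5 / 12.
  suff : (4 * kappa * d%:R) * (1 + kappa) <= 1 * (5 / 4) by nra.
  apply: ler_pM; rewrite ?mulr_ge0 ?addr_ge0//; last lra.
  by rewrite mulrAC.
have := aq j; have := qkappa j; rewrite !ler_norml => /andP[? _] /andP[? _] ?.
by lra.
Qed.

End perturbation.

End simplex.

(** Every vector of the cone around w is a positive multiple of a vector close
   to w; the multiple is read off the coordinate c, where w is 1 or -1. *)
Definition cone (R : realType) d (w : 'rV[R]_d) (c : 'I_d) (kappa delta : R) :
    set 'rV[R]_d :=
  [set v | 0 < v ord0 c * w ord0 c < delta /\ forall j,
     `|v ord0 j - v ord0 c * w ord0 c * w ord0 j| < kappa * (v ord0 c * w ord0 c)].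

Section cone.
Context (R : realType) (d : nat) (w : 'rV[R]_d) (c : 'I_d) (kappa delta : R).

Lemma measurable_cone : measurable (cone w c kappa delta).
Proof.
have ms : measurable_fun setT (fun v : 'rV[R]_d => v ord0 c * w ord0 c).
  by apply: measurable_funM => //; exact: (measurable_rV_coord c).
apply: measurableI.
  rewrite (_ : (fun _ => _) = [set v : 'rV[R]_d | 0 < v ord0 c * w ord0 c] `&`
      [set v : 'rV[R]_d | v ord0 c * w ord0 c < delta]); last first.
    by apply/seteqP; split => v /=; [move=> /andP[]|move=> []->].
  by apply: measurableI; apply: measurable_set_lt => //; exact: measurable_cst.
apply: measurable_fin_forall => j; apply: measurable_set_lt.
  apply: measurableT_comp => //; apply: measurable_funB.
    exact: (measurable_rV_coord j).
  by apply: measurable_funM => //; exact: measurable_cst.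
by apply: measurable_funM => //; exact: measurable_cst.
Qed.

Hypotheses (wc : w ord0 c * w ord0 c = 1) (w1 : forall j, `|w ord0 j| <= 1).
Hypotheses (kappa0 : 0 < kappa) (kappa1 : kappa <= 1).

Lemma cone_bounded v j : cone w c kappa delta v -> `|v ord0 j| < 2 * delta.
Proof.
move=> [/andP[+ +] /(_ j)]; set s := _ * _ => s0 sdelta vj.
rewrite -[v _ _](subrK (s * w ord0 j)) (le_lt_trans (ler_normD _ _))//.
have : `|s * w ord0 j| <= s by rewrite normrM gtr0_norm// ler_piMr// ltW.
have : kappa * s <= s by rewrite ler_piMl// ltW.
move: vj; lra.
Qed.

Lemma cone_axis t : 0 < t < delta ->
  exists2 rho, 0 < rho & open_cube (t *: w) rho `<=` cone w c kappa delta.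
Proof.
move=> /andP[t0 tdelta].
(* moving t *: w by rho moves the multiple read at c by at most rho, hence the
   distance to the axis by at most 2 rho, whereas the width allowed is at least
   kappa * t - rho *)
pose rho := Num.min (delta - t) (kappa * t / 3).
have rho0 : 0 < rho by rewrite lt_min subr_gt0 tdelta/= divr_gt0// mulr_gt0.
exists rho => // v vt.
have rho1 : rho <= delta - t by rewrite ge_min lexx.
have rho2 : rho <= kappa * t / 3 by rewrite ge_min lexx orbT.
set s := v ord0 c * w ord0 c.
have wcn : `|w ord0 c| = 1.
  have : `|w ord0 c| ^+ 2 = 1 by rewrite -normrX expr2 wc normr1.
  by move/eqP; rewrite sqrp_eq1// => /eqP.
have st : `|s - t| < rho.
  have -> : s - t = (v ord0 c - t * w ord0 c) * w ord0 c.
    by rewrite mulrBl -mulrA wc mulr1.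
  by rewrite normrM wcn mulr1; have := vt c; rewrite mxE.
have kt : kappa * t <= t by rewrite ler_piMl// ltW.
have kt0 : 0 < kappa * t by rewrite mulr_gt0.
have /andP[st1 st2] : - rho < s - t < rho by rewrite -ltr_norml.
have s0 : 0 < s by lra.
split; rewrite -/s; first by apply/andP; split => //; lra.
move=> j.
have -> : v ord0 j - s * w ord0 j =
    (v ord0 j - t * w ord0 j) - (s - t) * w ord0 j by ring.
rewrite (le_lt_trans (ler_normB _ _))//.
have : `|v ord0 j - t * w ord0 j| < rho by have := vt j; rewrite mxE.
have : `|(s - t) * w ord0 j| <= `|s - t| by rewrite normrM ler_piMr.
have : kappa * (t - s) <= rho.
  by apply: (@le_trans _ _ (1 * rho)); rewrite ?mul1r//;
    have [?|?] := leP 0 (t - s); nra.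
have : `|s - t| < rho by [].
nra.
Qed.

End cone.

Section facing_cones.
Context (R : realType) (d : nat) (hd : (0 < d)%N).

(** With -(1, ..., 1), put at index 0, the vectors of the canonical basis
   surround the origin. *)
Definition axis (k : 'I_d.+1) : 'rV[R]_d :=
  if unlift ord0 k is Some i then delta_mx 0 i else const_mx (-1).

Definition axis_coord (k : 'I_d.+1) : 'I_d := odflt (Ordinal hd) (unlift ord0 k).

Lemma axis_coord_unit k :
  axis k ord0 (axis_coord k) * axis k ord0 (axis_coord k) = 1.
Proof.
rewrite /axis /axis_coord; case: unlift => [i|]/=; rewrite !mxE ?eqxx ?mulr1//.
by rewrite mulrNN mulr1.
Qed.

Lemma axis_le1 k j : `|axis k ord0 j| <= 1.
Proof.
rewrite /axis; case: unlift => [i|]/=; rewrite !mxE ?normrN1// normr_nat.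
by case: (_ && _).
Qed.

(** Small enough for matrices close to the identity up to aperture to be
   invertible, with a positive solution when the right-hand side is close to
   (1, ..., 1). *)
Definition aperture : R := (4 * d%:R)^-1.

Lemma aperture_gt0 : 0 < aperture.
Proof. by rewrite invr_gt0 mulr_gt0// ltr0n. Qed.

Lemma aperture_le : aperture <= 4^-1.
Proof. by rewrite lef_pV2 ?posrE ?mulr_gt0 ?ltr0n// ler_peMr// ler1n. Qed.

Definition facing_cone (delta : R) (k : 'I_d.+1) : set 'rV[R]_d :=
  cone (axis k) (axis_coord k) aperture delta.

Lemma facing_cone0E delta v : facing_cone delta ord0 v ->
  0 < - v ord0 (Ordinal hd) /\
  forall j, `|v ord0 j - v ord0 (Ordinal hd)| < aperture * - v ord0 (Ordinal hd).
Proof.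
rewrite /facing_cone /cone /axis /axis_coord unlift_none /= !mxE mulrN1.
by move=> [/andP[? _] vj]; split => // j; have := vj j; rewrite mxE mulrN1 opprK.
Qed.

Lemma facing_coneSE delta i v : facing_cone delta (lift ord0 i) v ->
  0 < v ord0 i /\
  forall j, `|v ord0 j - v ord0 i * (j == i)%:R| < aperture * v ord0 i.
Proof.
rewrite /facing_cone /cone /axis /axis_coord liftK /= !mxE !eqxx mulr1.
by move=> [/andP[? _] vj]; split => // j; have := vj j; rewrite mxE eqxx.
Qed.

Lemma facing_cone_inj delta k k' v :
  facing_cone delta k v -> facing_cone delta k' v -> k = k'.
Proof.
have k4 := aperture_le; have k0 := aperture_gt0.
have H0S i : facing_cone delta ord0 v -> facing_cone delta (lift ord0 i) v -> False.
  move=> /facing_cone0E[v0 /(_ i)]; rewrite ltr_norml => /andP[_ h].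
  by move=> /facing_coneSE[vi _]; nra.
have [i ->|->] := unliftP ord0 k; have [j ->|->] := unliftP ord0 k' => //.
- move=> /facing_coneSE[vi /(_ j) hi] /facing_coneSE[vj /(_ i) hj].
  have [->//|ij] := eqVneq i j.
  move: hi hj; rewrite (negbTE ij) eq_sym (negbTE ij) !mulr0 !subr0.
  rewrite !gtr0_norm//; move: vi vj k4 k0; clear=> *; exfalso; nra.
- by move=> /[swap] /H0S h /h.
- by move=> /H0S h /h.
Qed.

(** One point in each cone: the origin is a positive combination of them and
   they span the space, so they form a simplex around the origin. *)
Lemma facing_cones_separate delta (p : 'I_d.+1 -> 'rV[R]_d) (y : 'rV[R]_d) j0 :
  (forall k, facing_cone delta k (p k)) -> 2 * delta < `|y ord0 j0| ->
  exists l, forall u : 'rV[R]_d,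
    (forall i, i != l -> \sum_j p i ord0 j * u ord0 j = 1) ->
    1 <= \sum_j y ord0 j * u ord0 j.
Proof.
move=> pC ydelta.
pose s0 := - p ord0 ord0 (Ordinal hd).
pose s i := p (lift ord0 i) ord0 i.
have [s0_gt0 p0E] : 0 < s0 /\ forall j, `|p ord0 ord0 j + s0| < aperture * s0.
  by have [] := facing_cone0E (pC ord0).
have s_gt0 i : 0 < s i by have [] := facing_coneSE (pC (lift ord0 i)).
have pE i j : `|p (lift ord0 i) ord0 j - s i * (j == i)%:R| < aperture * s i.
  by have [_] := facing_coneSE (pC (lift ord0 i)).
(* the rows of 1%:M + E are the points p (lift ord0 i), rescaled *)
pose E : 'M[R]_d := \matrix_(i, j) (p (lift ord0 i) ord0 j / s i - (j == i)%:R).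
have Eap i j : `|E i j| <= aperture.
  have si0 := lt0r_neq0 (s_gt0 i).
  have si0V : 0 < (s i)^-1 by rewrite invr_gt0.
  rewrite mxE -[_%:R](mulKf si0) [_^-1 * _]mulrC -mulrBl normrM (gtr0_norm si0V).
  by rewrite ler_pdivrMr// ltW.
have dap : 4 * d%:R * aperture <= 1.
  by rewrite mulfV// mulf_neq0// pnatr_eq0 -lt0n.
have QE i : row i (1%:M + E) = (s i)^-1 *: p (lift ord0 i).
  by apply/rowP => j; rewrite !mxE eq_sym addrC subrK mulrC.
have Qu : 1%:M + E \in unitmx by exact: perturbed_identity_unitmx Eap dap.
have combE (b : 'rV[R]_d) :
    \sum_i (b ord0 i / s i) *: p (lift ord0 i) = b *m (1%:M + E).
  by rewrite mulmx_sum_row; apply: eq_bigr => i _; rewrite QE scalerA.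
pose q := - s0^-1 *: p ord0.
pose a := q *m invmx (1%:M + E).
have a_gt0 : forall j, 0 < a ord0 j.
  apply: (perturbed_identity_positive_solution Eap dap aperture_le (q := q)).
    move=> j; have s00 := lt0r_neq0 s0_gt0.
    rewrite mxE -[1](mulVf s00) mulNr -opprD normrN -mulrDr normrM.
    rewrite gtr0_norm ?invr_gt0//.
    by rewrite mulrC ler_pdivrMr// ltW.
  by rewrite /a mulmxKV.
pose coef (c0 : R) (c : 'rV[R]_d) k :=
  if unlift ord0 k is Some i then c ord0 i / s i else c0.
have coefE c0 c :
    \sum_k coef c0 c k *: p k = c0 *: p ord0 + c *m (1%:M + E).
  rewrite big_ord_recl -combE /coef unlift_none; congr (_ + _).
  by apply: eq_bigr => i _; rewrite liftK.
apply: (@far_point_beyond_facet _ _ p (coef s0^-1 a)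
    (coef 0 (y *m invmx (1%:M + E))) (2 * delta) y j0) => //.
- move=> k; rewrite /coef; case: unlift => [i|]; last by rewrite invr_gt0.
  by rewrite divr_gt0.
- by rewrite coefE /a mulmxKV// /q scaleNr subrr.
- by rewrite coefE scale0r add0r mulmxKV.
- move=> i j; apply: ltW; apply: cone_bounded (pC i).
  + exact: axis_le1.
  + by have := aperture_le; lra.
Qed.

End facing_cones.

(** * Hyperplanes through d points *)

Section normal.
Context (R : realType) (d : nat).
Implicit Types (q : 'I_d -> 'rV[R]_d) (x y z : 'rV[R]_d).

Definition dot (u v : 'rV[R]_d) : R := \sum_(j < d) u ord0 j * v ord0 j.

Lemma dotDl u u' v : dot (u + u') v = dot u v + dot u' v.
Proof. by rewrite /dot -big_split/=; apply: eq_bigr => j _; rewrite mxE mulrDl. Qed.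

Lemma dotZl a u v : dot (a *: u) v = a * dot u v.
Proof. by rewrite /dot mulr_sumr; apply: eq_bigr => j _; rewrite mxE mulrA. Qed.

Lemma dotC u v : dot u v = dot v u.
Proof. by apply: eq_bigr => j _; rewrite mulrC. Qed.

Lemma dotNl u v : dot (- u) v = - dot u v.
Proof. by rewrite -scaleN1r dotZl mulN1r. Qed.

Lemma dotBr u v v' : dot u (v - v') = dot u v - dot u v'.
Proof. by rewrite dotC dotDl dotNl !(dotC _ u). Qed.

Definition edges x q : 'M[R]_d := \matrix_(i, j) (q i - x) ord0 j.

(** When x is not on the hyperplane through the points q, that hyperplane is
   the set of the z such that dot (z - x) (normal x q) = 1. The explicit
   formula makes measurability clear. *)
Definition normal x q : 'rV[R]_d :=
  \row_j ((\det (edges x q))^-1 * \sum_i \adj (edges x q) j i).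

Hypothesis d_gt0 : (0 < d)%N.

Section nondegenerate.
Context x q (q_nd : \det (edges x q) != 0).

Lemma dot_normal i : dot (q i - x) (normal x q) = 1.
Proof.
rewrite /dot (eq_bigr (fun j => \sum_k (\det (edges x q))^-1 *
    (edges x q i j * \adj (edges x q) j k))); last first.
  move=> j _; rewrite [normal _ _ _ _]mxE mulrCA !mulr_sumr.
  by apply: eq_bigr => k _; rewrite [edges _ _ _ _]mxE.
rewrite exchange_big/=; under eq_bigr do rewrite -mulr_sumr.
rewrite -mulr_sumr (eq_bigr (fun k => (edges x q *m \adj (edges x q)) i k)).
  rewrite mul_mx_adj (bigD1 i)//= big1 ?addr0.
    by rewrite mxE eqxx mulr1n mulVf.
  by move=> k ki; rewrite mxE eq_sym (negbTE ki).
by move=> k _; rewrite mxE.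
Qed.

Lemma hyperplane_throughE :
  hyperplane_through (range q) = [set z | dot (z - x) (normal x q) = 1].
Proof.
set u := normal x q.
apply/seteqP; split => [z|z /= zu].
  apply; split; last by move=> _ [i _ <-]; exact: dot_normal.
  exists u, (1 + dot x u); split.
    apply/eqP => u0; have := dot_normal (Ordinal d_gt0).
    rewrite -/u u0 /dot big1 => [/eqP|j _]; first by rewrite eq_sym oner_eq0.
    by rewrite [X in _ * X]mxE mulr0.
  apply/seteqP; split => z' /=; rewrite -/(dot u z') dotDl dotNl (dotC z').
    by move/eqP; rewrite subr_eq => /eqP.
  by move=> ->; rewrite addrK.
move=> _ [[v [c [v0 ->]]] qv] /=; rewrite -/(dot v z).
have vu : v = (c - dot v x) *: u.
  apply: (can_inj (@trmxK _ _ _)).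
  have := q_nd; rewrite -unitfE -unitmxE => /mulKmx edgesK.
  apply: (can_inj (edgesK 1%N)); apply/matrixP => i k; rewrite (ord1 k).
  transitivity (dot (q i - x) v).
    by rewrite mxE; apply: eq_bigr => j _; rewrite mxE [_^T _ _]mxE.
  transitivity (dot (q i - x) ((c - dot v x) *: u)); last first.
    by rewrite mxE; apply: eq_bigr => j _; rewrite [edges _ _ _ _]mxE [_^T _ _]mxE.
  rewrite [RHS]dotC dotZl [dot u _]dotC dot_normal mulr1 dotDl dotNl.
  congr (_ - _); last exact: dotC.
  have : range q (q i) by exists i.
  by move/qv => /=; rewrite dotC.
have := zu; rewrite dotDl dotNl => zu1.
have E : dot v z - dot v x = c - dot v x.
  rewrite {1 2}vu !dotZl -mulrBr ![dot u _]dotC zu1.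
  exact: mulr1.
by apply: (addIr (- dot v x)).
Qed.

Lemma segment_meets_hyperplane y :
  (segment x y `&` hyperplane_through (range q) !=set0) <->
  1 <= dot (y - x) (normal x q).
Proof.
rewrite hyperplane_throughE.
have dotE t : dot ((1 - t) *: x + t *: y - x) (normal x q) =
    t * dot (y - x) (normal x q).
  rewrite -dotZl; congr dot.
  by apply/rowP => j; rewrite !mxE; ring.
split=> [[_ [[t /= /andP[t0 t1] <-]]] /=|h].
  rewrite dotE => th; rewrite leNgt; apply/negP => h1.
  have [h0|h0] := leP 0 (dot (y - x) (normal x q)); last first.
    by have := mulr_ge0_le0 t0 (ltW h0); rewrite th ler10.
  have : t * dot (y - x) (normal x q) <= dot (y - x) (normal x q).
    by rewrite ler_piMl.
  by rewrite th leNgt h1.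
have s0 : 0 < dot (y - x) (normal x q) by apply: lt_le_trans h.
pose t := (dot (y - x) (normal x q))^-1.
exists ((1 - t) *: x + t *: y); split => /=.
  by exists t => //=; rewrite invr_ge0 ltW//= invf_le1.
by rewrite dotE mulVf// gt_eqF.
Qed.

End nondegenerate.

End normal.

Lemma measurable_fun_det d (T : measurableType d) (R : realType) n
    (A : T -> 'M[R]_n) :
  (forall i j, measurable_fun [set: T] (fun t => A t i j)) ->
  measurable_fun [set: T] (fun t => \det (A t)).
Proof.
move=> mA; apply: measurable_sum => s; apply: measurable_funM.
  exact: measurable_cst.
by apply: measurable_prod => i _; exact: mA.
Qed.

Lemma measurable_invr (R : realType) : measurable_fun [set: R] (@GRing.inv R).
Proof.
rewrite (_ : GRing.inv = fun x => x * ((x ^+ 2) `^ (-1))).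
  apply: measurable_funM => //.
  by apply: (measurableT_comp (measurable_powR _)); exact: measurable_funX.
apply/funext => x; rewrite powR_inv1 ?sqr_ge0//.
have [->|x0] := eqVneq x 0; first by rewrite invr0 mul0r.
by rewrite expr2 invfM mulVKf.
Qed.

Section measurable_normal.
Context d (T : measurableType d) (R : realType) (n : nat).
Context (x : 'rV[R]_n) (q : T -> 'I_n -> 'rV[R]_n).
Hypothesis mq : forall i, measurable_fun [set: T] (fun t => q t i).

Lemma measurable_edges i j : measurable_fun [set: T] (fun t => edges x (q t) i j).
Proof.
rewrite (_ : (fun _ => _) = fun t => rV_coord j (q t i) - x ord0 j); last first.
  by apply/funext => t; rewrite !mxE.
apply: measurable_funB => //.
by apply: (measurableT_comp (measurable_rV_coord j)).
Qed.

Lemma measurable_normal : measurable_fun [set: T] (fun t => normal x (q t)).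
Proof.
apply: measurable_fun_rV => j.
rewrite (_ : _ \o _ = fun t => (\det (edges x (q t)))^-1 *
    \sum_i \adj (edges x (q t)) j i); last first.
  by apply/funext => t; rewrite /rV_coord/= mxE.
apply: measurable_funM.
  apply: (measurableT_comp (@measurable_invr R)).
  by apply: measurable_fun_det; exact: measurable_edges.
apply: measurable_sum => i.
rewrite (_ : (fun _ => _) = fun t =>
    (-1) ^+ (i + j) * \det (row' i (col' j (edges x (q t))))); last first.
  by apply/funext => t; rewrite mxE.
apply: measurable_funM; first exact: measurable_cst.
apply: measurable_fun_det => k l.
rewrite (_ : (fun _ => _) = fun t => edges x (q t) (lift i k) (lift j l)).
  exact: measurable_edges.
by apply/funext => t; rewrite !mxE.
Qed.

End measurable_normal.

(** * Neighbours and counts of separating hyperplanes *)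

Lemma dot_le_l1 (R : realType) d (v u : 'rV[R]_d) (eta : R) :
  (forall j, `|v ord0 j| <= eta) -> dot v u <= eta * \sum_j `|u ord0 j|.
Proof.
move=> veta; rewrite mulr_sumr; apply: ler_sum => j _.
by rewrite (le_trans (ler_norm _))// normrM ler_wpM2r.
Qed.

(** The ordering of the sample depends on the data only through the table that
   tells, for each hyperplane S and each sample point j, whether S separates j
   from x. *)
Section order_of_table.
Context (d n : nat).
Implicit Type c : {set 'I_n} -> 'I_n -> bool.

Definition table_count c (j : 'I_n) : nat :=
  (\sum_(S : {set 'I_n} | #|S| == d) c S j)%N.

Definition table_closer c : rel 'I_n := fun i j =>
  ((table_count c i < table_count c j) ||
   ((table_count c i == table_count c j) && (i <= j)))%N.

Definition table_order c : seq 'I_n := sort (table_closer c) (enum 'I_n).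

Definition neighbour c k i : bool := i \in take k (table_order c).

Lemma table_closer_total c : total (table_closer c).
Proof.
by move=> i j; rewrite /table_closer; lia.
Qed.

Lemma table_closer_trans c : transitive (table_closer c).
Proof.
by move=> j i k; rewrite /table_closer; lia.
Qed.

Lemma table_order_uniq c : uniq (table_order c).
Proof. by rewrite sort_uniq enum_uniq. Qed.

Lemma mem_table_order c i : i \in table_order c.
Proof. by rewrite mem_sort mem_enum. Qed.

(** The k indices of B would all come before an index of count at least tau. *)
Lemma neighbour_count_lt c k (B : {set 'I_n}) tau i :
  (k <= #|B|)%N -> (forall j, j \in B -> (table_count c j < tau)%N) ->
  neighbour c k i -> (table_count c i < tau)%N.
Proof.
move=> kB Btau iN; rewrite ltnNge; apply/negP => taui.
set s := table_order c; set a := index i s.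
have ak : (a < k)%N by move: iN; rewrite /neighbour in_take ?mem_table_order.
have sB : {subset enum B <= take a s}.
  move=> j; rewrite mem_enum => jB.
  rewrite in_take ?mem_table_order// ltnNge; apply/negP => aj.
  have : table_closer c i j.
    have := sort_sorted (@table_closer_total c) (enum 'I_n).
    rewrite -/(table_order c) -/s => ss; move: aj; rewrite leq_eqVlt => /orP[/eqP aj|aj].
      have -> : i = j.
        rewrite -(nth_index i (mem_table_order c i)) -/s -/a aj.
        by rewrite nth_index ?mem_table_order.
      by have := table_closer_total c j j; rewrite orbb.
    have := sorted_ltn_nth (@table_closer_trans c) i ss.
    move=> /(_ a (index j s)); rewrite !inE !index_mem !mem_table_order.
    move=> /(_ isT isT aj).
    by rewrite !nth_index ?mem_table_order.
  have := Btau _ jB; rewrite /table_closer => jt.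
  by move=> /orP[|/andP[]]; lia.
have := uniq_leq_size (enum_uniq B) sB; rewrite -cardE size_take_min => h.
by have := geq_minl a (size s); lia.
Qed.

End order_of_table.

Section empirical_table.
Context (R : realType) (d n : nat) (d_gt0 : (0 < d)%N).
Implicit Types (pts : 'I_n -> 'rV[R]_d) (x y : 'rV[R]_d) (S : {set 'I_n}).

Definition facet_points pts S (i : 'I_d) : 'rV[R]_d :=
  nth 0 [seq pts j | j <- enum S] i.

Lemma mem_facet_points pts S j : #|S| = d -> j \in S ->
  exists i, facet_points pts S i = pts j.
Proof.
move=> Sd jS; have jS' : (index j (enum S) < d)%N.
  by rewrite -Sd cardE index_mem mem_enum.
exists (Ordinal jS'); rewrite /facet_points /= (nth_map j) ?nth_index ?mem_enum//.
by rewrite index_mem mem_enum.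
Qed.

Lemma range_facet_points pts S : #|S| = d ->
  range (facet_points pts S) = pts @` [set` S].
Proof.
move=> Sd; apply/seteqP; split => [_ [i _ <-]|_ [j /= jS <-]].
  have iS : (i < size (enum S))%N by rewrite -cardE Sd.
  rewrite /facet_points; case: (enum S) (mem_enum S) iS => // j0 s sE iS.
  rewrite (nth_map j0)//; exists (nth j0 (j0 :: s) i) => //=.
  by rewrite -sE mem_nth.
by have [i <-] := mem_facet_points pts Sd jS; exists i.
Qed.

Definition crosses pts x S y : bool :=
  1 <= dot (y - x) (normal x (facet_points pts S)).

Definition general_position pts x :=
  forall S, #|S| = d -> \det (edges x (facet_points pts S)) != 0.

Definition cross_table pts x S j := crosses pts x S (pts j).

Lemma empirical_distanceE pts x y : general_position pts x ->
  empirical_distance pts x y = (\sum_(S : {set 'I_n} | #|S| == d) crosses pts x S y)%N.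
Proof.
move=> nd; apply: eq_bigr => S /eqP Sd; congr nat_of_bool.
rewrite -range_facet_points//; apply/asboolP/idP => [|h].
  by move/(segment_meets_hyperplane d_gt0 (nd _ Sd)).
exact/(segment_meets_hyperplane d_gt0 (nd _ Sd)).
Qed.

Lemma nn_orderE pts x : general_position pts x ->
  nn_order pts x = table_order d (cross_table pts x).
Proof.
move=> nd; congr sort; apply/funext => i; apply/funext => j.
by rewrite /closer !empirical_distanceE.
Qed.

(** Whatever the point near x, the hyperplanes that separate it from x are among
   those with a large normal. *)
Lemma near_point_count pts x j (eta : R) :
  (forall m, `|(pts j - x) ord0 m| <= eta) -> 0 < eta ->
  (table_count d (cross_table pts x) j <=
   \sum_(S : {set 'I_n} | #|S| == d)
     (eta^-1 <= \sum_m `|normal x (facet_points pts S) ord0 m|)%R)%N.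
Proof.
move=> jeta eta0; apply: leq_sum => S _.
rewrite /cross_table /crosses; case: leP => // h1.
rewrite lt0b -[eta^-1]mulr1 ler_pdivrMl//.
by apply: le_trans h1 _; exact: dot_le_l1.
Qed.

(** Each choice of one sample point in every cone gives a simplex around x, and
   one of its facets crosses the segment from x to the far point y; the choice
   can be recovered from this facet and the opposite vertex. *)
Lemma far_point_count pts x y (delta : R) j0 :
  general_position pts x -> 2 * delta < `|(y - x) ord0 j0| ->
  (\prod_(k < d.+1) #|[set j | `[< facing_cone d_gt0 delta k (pts j - x)%R >]]%SET| <=
   n * \sum_(S : {set 'I_n} | #|S| == d) crosses pts x S y)%N.
Proof.
move=> nd ydelta.
pose J k := [set j | `[< facing_cone d_gt0 delta k (pts j - x) >]]%SET.
pose F := family (fun k => mem (J k)) : pred {ffun 'I_d.+1 -> 'I_n}.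
have FJ f k : f \in F -> facing_cone d_gt0 delta k (pts (f k) - x).
  by move/familyP => /(_ k); rewrite /= inE => /asboolP.
have Finj f : f \in F -> injective f.
  move=> fF k k' ff; apply: (facing_cone_inj (FJ f k fF)).
  by rewrite ff; exact: FJ.
pose facet (f : {ffun 'I_d.+1 -> 'I_n}) l := f @: [set~ l]%SET.
have facet_card f l : f \in F -> #|facet f l| = d.
  move=> /Finj fi; transitivity #|[set~ l]%SET|; first exact: card_imset.
  by rewrite cardsC1 card_ord.
have facet_crosses f : f \in F -> exists l, crosses pts x (facet f l) y.
  move=> fF; have [l h] := facing_cones_separate (fun k => FJ f k fF) ydelta.
  exists l; apply: h => i il.
  have iS : f i \in facet f l by rewrite imset_f// !inE.
  have [m qm] := mem_facet_points pts (facet_card _ l fF) iS.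
  by rewrite -qm; apply: dot_normal; exact/nd/facet_card.
pose L f := odflt ord0 [pick l | crosses pts x (facet f l) y].
have LP f : f \in F -> crosses pts x (facet f (L f)) y.
  move=> /facet_crosses[l lP]; rewrite /L; case: pickP => //= /(_ l).
  by rewrite lP.
pose phi (f : {ffun 'I_d.+1 -> 'I_n}) := (f (L f), facet f (L f)).
pose Ty := [set S : {set 'I_n} | (#|S| == d) && crosses pts x S y]%SET.
have imF (f : {ffun 'I_d.+1 -> 'I_n}) :
    f @: [set: 'I_d.+1]%SET = f (L f) |: facet f (L f).
  have -> : [set: 'I_d.+1]%SET = L f |: [set~ L f]%SET by rewrite finset.setUCr.
  by rewrite imsetU1.
have phi_inj : {in F &, injective phi}.
  move=> f g fF gF [fg1 fg2]; apply/ffunP => k.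
  have : f k \in g @: [set: 'I_d.+1]%SET by rewrite imF -fg1 -fg2 -imF imset_f.
  case/imsetP => k' _ fgk.
  rewrite fgk; congr (g _); apply: (facing_cone_inj (FJ g k' gF)).
  by rewrite -fgk; exact: FJ.
have -> : (\prod_(k < d.+1) #|J k| = #|F|)%N.
  by rewrite card_family foldrE big_map big_enum.
rewrite -(card_in_imset phi_inj).
have -> : (\sum_(S : {set 'I_n} | #|S| == d) crosses pts x S y = #|Ty|)%N.
  by rewrite -big_mkcondr/= sum1_card; apply: eq_card => S; rewrite !inE.
rewrite -[X in (_ <= X * _)%N]card_ord -cardsT -cardsX.
apply: subset_leq_card; apply/fintype.subsetP => _ /imsetP[f fF ->].
by rewrite !inE/= facet_card// eqxx LP.
Qed.

End empirical_table.

(** * Joint laws of independent random elements *)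

Lemma integrable_bounded_fun d (T : measurableType d) (R : realType)
    (m : {measure set T -> \bar R}) (f : T -> R) (M : R) :
  (m setT <= 1)%E -> measurable_fun setT f -> (forall t, `|f t| <= M) ->
  m.-integrable setT (EFin \o f).
Proof.
move=> mfin mf fM; apply: measurable_bounded_integrable => //.
  by apply: le_lt_trans mfin _; exact: ltry.
exists M; split; first exact: num_real.
by move=> N MN u _ /=; rewrite (le_trans (fM u))// ltW.
Qed.

(** Boxes are stable under intersection and generate the measurable sets of
   tuples. *)
Lemma tuple_measure_unique d (T : measurableType d) (R : realType) n
    (m1 m2 : {measure set (n.-tuple T) -> \bar R}) :
  (m1 setT < +oo)%E ->
  (forall B : 'I_n -> set T, (forall i, measurable (B i)) ->
    m1 [set t | forall i, B i (tnth t i)] = m2 [set t | forall i, B i (tnth t i)]) ->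
  forall A, measurable A -> m1 A = m2 A.
Proof.
move=> m1fin m12.
pose G := [set [set t : n.-tuple T | forall i, B i (tnth t i)] |
  B in [set B : 'I_n -> set T | forall i, measurable (B i)]].
have Gm : G `<=` measurable.
  move=> _ [B /= mB <-]; apply: measurable_fin_forall => i.
  by apply: (measurable_preimage_fun (f := fun t => tnth t i)) => //; exact: measurable_tnth.
apply: (measure_unique G (fun=> setT)) => //.
- apply/seteqP; split; last exact: (smallest_sub (@sigma_algebra_measurable _ _)).
  apply: smallest_sub; first exact: smallest_sigma_algebra.
  rewrite -bigcup_seq => _ [i _ [A mA <-]]; apply: sub_sigma_algebra.
  exists (fun j => if j == i then A else setT) => /=.
    by move=> j; case: ifP.
  rewrite setTI; apply/seteqP; split => t /=; first by move=> /(_ i); rewrite eqxx.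
  by move=> tA j; case: eqP => // ->.
- move=> _ _ [B mB <-] [C mC <-]; exists (fun i => B i `&` C i).
    by move=> i; exact: measurableI.
  apply/seteqP; split => t /=; first by move=> h; split => i; have [] := h i.
  by move=> [h1 h2] i; split.
- by move=> _; exists (fun=> setT) => //; apply/seteqP; split.
- by rewrite bigcup_const.
- by move=> _ [B mB <-]; exact: m12.
Qed.

Section independent_family.
Context d (Omega : measurableType d) (R : realType) (P : probability Omega R).
Context d' (T : measurableType d').

Definition product_rule n (Z : 'I_n -> {RV P >-> T}) :=
  forall B : 'I_n -> set T, (forall i, measurable (B i)) ->
    P [set w | forall i, B i (Z i w)] = (\prod_(i < n) P (Z i @^-1` B i))%E.

Lemma mutually_independent_product_rule (I : choiceType) (Z : I -> Omega -> T)
    n (s : 'I_n -> I) (Z' : 'I_n -> {RV P >-> T}) :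
  mutually_independent P Z -> injective s -> (forall i, Z (s i) = Z' i) ->
  product_rule Z'.
Proof.
move=> indZ sinj ZZ' B mB.
pose B' (j : I) := if [pick i | s i == j] is Some i then B i else setT.
have B's i : B' (s i) = B i.
  rewrite /B'; case: pickP => [k /eqP/sinj -> //|/(_ i)]; by rewrite eqxx.
have mB' j : measurable (B' j) by rewrite /B'; case: pickP.
have := indZ (imfset imfset_key s (mem (finset.setT : {set 'I_n}))) B' mB'.
rewrite big_imfset/=; last by move=> ? ? _ _; exact: sinj.
rewrite (_ : \bigcap_(i in _) _ = [set w | forall i, B i (Z' i w)]).
  move=> ->; rewrite big_enum_cond/=.
  under eq_bigl do rewrite inE.
  by apply: eq_bigr => i _; rewrite B's ZZ'.
apply/seteqP; split => w /= h.
  move=> i; rewrite -ZZ' -B's; apply: h => /=.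
  by rewrite in_imfset//= inE.
by move=> _ /imfsetP[i _ ->] /=; rewrite B's ZZ'.
Qed.

Section tuple_of_family.
Context n (Z : 'I_n -> {RV P >-> T}).

Definition tuple_of (w : Omega) : n.-tuple T := [tuple Z i w | i < n].

Lemma measurable_tuple_of : measurable_fun [set: Omega] tuple_of.
Proof.
apply/measurable_fun_tnthP => i.
by rewrite (_ : _ \o _ = Z i)//; apply/funext => w /=; rewrite tnth_mktuple.
Qed.

HB.instance Definition _ :=
  isMeasurableFun.Build _ _ _ _ tuple_of measurable_tuple_of.

End tuple_of_family.

Lemma eq_joint_law n (Z Z' : 'I_n -> {RV P >-> T}) :
  product_rule Z -> product_rule Z' ->
  (forall i B, measurable B -> P (Z i @^-1` B) = P (Z' i @^-1` B)) ->
  forall A, measurable A -> P (tuple_of Z @^-1` A) = P (tuple_of Z' @^-1` A).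
Proof.
move=> prZ prZ' ZZ'; apply: (tuple_measure_unique (m1 := distribution P (tuple_of Z))
  (m2 := distribution P (tuple_of Z'))).
  by apply: (@le_lt_trans _ _ 1%E); [exact: probability_le1|exact: ltry].
move=> B mB.
have E (V : 'I_n -> {RV P >-> T}) :
    distribution P (tuple_of V) [set t | forall i, B i (tnth t i)] =
    P [set w | forall i, B i (V i w)].
  rewrite /distribution /pushforward; congr (P _).
  by apply/seteqP; split => w /= h i; have := h i; rewrite tnth_mktuple.
apply: (etrans (E Z)); apply/esym/(etrans (E Z')).
by rewrite prZ// prZ'//; apply: eq_bigr => i _; exact/esym/ZZ'.
Qed.

Section one_against_others.
Context n (Z : 'I_n -> {RV P >-> T}) (prZ : product_rule Z) (i0 : 'I_n) (t0 : T).

(** Freezing the entry i0 at t0 keeps the length of the tuple and makes it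
   independent of Z i0. *)
Definition others_at (l : 'I_n) : {RV P >-> T} :=
  if l == i0 then [the {mfun Omega >-> T} of cst t0] else Z l.

Definition others : {RV P >-> n.-tuple T} := [the {mfun _ >-> _} of tuple_of others_at].

Definition one_and_others (w : Omega) : T * n.-tuple T := (Z i0 w, others w).

Lemma measurable_one_and_others : measurable_fun [set: Omega] one_and_others.
Proof.
by apply/measurable_fun_pairP; split; exact: measurable_funP.
Qed.

HB.instance Definition _ :=
  isMeasurableFun.Build _ _ _ _ one_and_others measurable_one_and_others.

Lemma one_independent_of_others A C : measurable A -> measurable C ->
  P (Z i0 @^-1` A `&` others @^-1` C) = (P (Z i0 @^-1` A) * P (others @^-1` C))%E.
Proof.
move=> mA mC.
have mZA : measurable (Z i0 @^-1` A) by apply: measurable_preimage_fun.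
have mO : measurable_fun [set: Omega] (others : Omega -> n.-tuple T).
  exact: measurable_funP.
pose m1 : {measure set (n.-tuple T) -> \bar R} :=
  measure_function_pushforward__canonical__measure_function_Measure
    (mrestr P mZA) mO.
have r0 : 0 <= fine (P (Z i0 @^-1` A)) by rewrite fine_ge0.
pose m2 : {measure set (n.-tuple T) -> \bar R} :=
  [the measure _ _ of mscale (NngNum r0) (distribution P others)].
have m2E D : m2 D = (P (Z i0 @^-1` A) * P (others @^-1` D))%E.
  by rewrite /m2/= /mscale/= fineK// fin_num_measure.
have -> : P (Z i0 @^-1` A `&` others @^-1` C) = m1 C.
  by rewrite /m1/= /pushforward /mrestr/= setIC.
rewrite -m2E; apply: tuple_measure_unique mC.
  rewrite /m1/= /pushforward /mrestr/=; apply: (@le_lt_trans _ _ 1%E); last exact: ltry.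
  by rewrite preimage_setT setTI; exact: probability_le1.
move=> B mB; rewrite m2E /m1/= /pushforward /mrestr/=.
pose B' (D : set T) l := if l == i0 then D else B l.
have mB' D : measurable D -> forall l, measurable (B' D l).
  by move=> mD l; rewrite /B'; case: ifP.
have prB' D : measurable D -> P [set w | forall l, B' D l (Z l w)] =
    (P (Z i0 @^-1` D) * \prod_(l < n | l != i0) P (Z l @^-1` B l))%E.
  move=> mD; rewrite prZ; last exact: mB'.
  rewrite (bigD1 i0)//= {1}/B' eqxx; congr (_ * _)%E.
  by apply: eq_bigr => l /negbTE ll; rewrite /B' ll.
have othersE w l : tnth (others w) l = if l == i0 then t0 else Z l w.
  by rewrite tnth_mktuple /others_at; case: ifP.
have [Bt0|Bt0] := pselect (B i0 t0); last first.
  have -> : others @^-1` [set t | forall i, B i (tnth t i)] = set0.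
    by apply/seteqP; split => // w /= /(_ i0); rewrite othersE eqxx.
  by rewrite set0I measure0 mule0.
have E : others @^-1` [set t | forall i, B i (tnth t i)] =
    [set w | forall l, B' setT l (Z l w)].
  apply/seteqP; split => w /= h l; have := h l; rewrite othersE /B';
  by case: eqP => // ->.
have EA : others @^-1` [set t | forall i, B i (tnth t i)] `&` Z i0 @^-1` A =
    [set w | forall l, B' A l (Z l w)].
  rewrite E; apply/seteqP; split => w /=.
    by move=> [h Aw] l; have := h l; rewrite /B'; case: eqP => // ->.
  move=> h; split; last by have := h i0; rewrite /B' eqxx.
  by move=> l; have := h l; rewrite /B'; case: eqP.
by rewrite EA E !prB'// preimage_setT probability_setT mul1e.
Qed.

Lemma one_and_others_law G : measurable G ->
  P (one_and_others @^-1` G) =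
  (distribution P (Z i0) \x distribution P others)%E G.
Proof.
move=> mG; rewrite -[LHS]/(distribution P one_and_others G).
apply/esym/product_measure_unique => // A C mA mC.
exact: one_independent_of_others.
Qed.

Lemma one_and_others_null G : measurable G ->
  (forall t, P (Z i0 @^-1` [set z | G (z, t)]) = 0%E) ->
  P (one_and_others @^-1` G) = 0%E.
Proof.
move=> mG G0; rewrite one_and_others_law//.
rewrite (product_measure_unique
    (m' := [the measure _ _ of product_measure2
      (distribution P (Z i0)) (distribution P others)]))//=.
  by rewrite /product_measure2 integral0_eq// => t _ /=;
    rewrite /distribution /pushforward -[RHS](G0 t);
    congr (P _); apply/seteqP; split => w /=; rewrite /ysection/= inE.
by move=> A B mA mB; rewrite product_measure2E.
Qed.

Lemma one_and_others_integral0 (F : T * n.-tuple T -> R) (M : R) :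
  measurable_fun setT F -> (forall z, `|F z| <= M) ->
  (forall t, (\int[P]_w (F (Z i0 w, t))%:E = 0)%E) ->
  (\int[P]_w (F (one_and_others w))%:E = 0)%E.
Proof.
move=> mF FM F0.
have mEF : measurable_fun setT (EFin \o F) by exact/measurable_EFinP.
have -> : (\int[P]_w (F (one_and_others w))%:E =
    \int[distribution P one_and_others]_z (F z)%:E)%E.
  rewrite (@integral_distribution _ _ _ _ _ P one_and_others (EFin \o F))//.
  apply: (integrable_bounded_fun (M := M)); first exact: probability_le1.
    by apply: measurableT_comp.
  by move=> w; exact: FM.
rewrite (eq_measure_integral
    (distribution P (Z i0) \x distribution P others)%E); last first.
  by move=> A mA _; exact: one_and_others_law.
rewrite -integral21_prod_meas1; last first.
  apply: (integrable_bounded_fun (M := M)) => //.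
  apply: (@le_trans _ _ (P (one_and_others @^-1` setT))).
    by rewrite one_and_others_law.
  rewrite preimage_setT; exact: probability_le1.
rewrite integral0_eq// => t _; rewrite /fubini_G.
rewrite (@integral_distribution _ _ _ _ _ P (Z i0) (fun z => (F (z, t))%:E))//.
- exact: F0.
- by apply/measurable_EFinP; apply: measurableT_comp => //; exact: measurable_pair2.
- apply: (integrable_bounded_fun (M := M)); first exact: probability_le1.
    apply: (measurableT_comp (f := fun z => F (z, t))) => //.
    by apply: measurableT_comp => //; exact: measurable_pair2.
  by move=> w; exact: FM.
Qed.

End one_against_others.

End independent_family.

(** * Second moment bounds *)

Section chebyshev.
Context d (Omega : measurableType d) (R : realType) (P : probability Omega R).

(** Orthogonality kills the cross terms in the integral of the square of the
   sum. *)
Lemma chebyshev_orthogonal n (f : 'I_n -> Omega -> R) (M C eps : R) :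
  (forall i, measurable_fun setT (f i)) -> (forall i w, `|f i w| <= M) ->
  (forall i j, i != j -> (\int[P]_w (f i w * f j w)%:E = 0)%E) ->
  (forall w, \sum_i f i w ^+ 2 <= C) -> 0 < eps ->
  (P [set w | (eps <= `|\sum_i f i w|)%R] <= (C / eps ^+ 2)%:E)%E.
Proof.
move=> mf fM forth fC eps0.
pose S w := \sum_i f i w.
have mS : measurable_fun setT S by exact: measurable_sum.
pose A := [set w | eps <= `|S w|].
have mA : measurable A by apply: measurable_set_le => //; exact: measurableT_comp.
have mff i j : measurable_fun setT (fun w => f i w * f j w) by exact: measurable_funM.
have iff i j : P.-integrable setT (EFin \o (fun w => f i w * f j w)).
  apply: (integrable_bounded_fun (M := M * M)) => //; first exact: probability_le1.
  by move=> w; rewrite normrM ler_pM.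
have intS : (\int[P]_w (S w ^+ 2)%:E <= C%:E)%E.
  have -> : (\int[P]_w (S w ^+ 2)%:E = \int[P]_w (\sum_i f i w ^+ 2)%:E)%E.
    under eq_integral => w _.
      rewrite expr2 mulr_suml (eq_bigr (fun i => \sum_j f i w * f j w)); last first.
        by move=> i _; rewrite mulr_sumr.
      rewrite -sumEFin; under eq_bigr do rewrite -sumEFin.
      over.
    under [in RHS]eq_integral => w _ do rewrite -sumEFin.
    rewrite integral_sum//; last first.
      by move=> i; apply: integrable_sum => // j _; exact: iff.
    rewrite integral_sum//; last by move=> i; exact: (iff i i).
    apply: eq_bigr => i _; rewrite integral_sum//; last by move=> j; exact: iff.
    rewrite (bigD1 i)//= big1 ?adde0//.
    by move=> j ji; rewrite forth// eq_sym.
  apply: (@le_trans _ _ (\int[P]_w (cst C%:E w))%E); last first.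
    by rewrite integral_cst//= probability_setT mule1.
  apply: ge0_le_integral => //.
  - by move=> w _; rewrite lee_fin sumr_ge0// => i _; exact: sqr_ge0.
  - apply/measurable_EFinP; apply: measurable_sum => i; exact: measurable_funX.
  - by move=> w _; rewrite lee_fin.
rewrite EFinM lee_pdivlMr ?exprn_gt0//.
apply: le_trans intS.
apply: (@le_trans _ _ (\int[P]_(w in A) (S w ^+ 2)%:E)%E); last first.
  apply: ge0_subset_integral => //.
    by apply/measurable_EFinP; exact: measurable_funX.
  by move=> w _; rewrite lee_fin sqr_ge0.
rewrite muleC -integral_cst//; apply: ge0_le_integral => //.
- by move=> w _; rewrite lee_fin sqr_ge0.
- by apply: measurable_funTS; apply/measurable_EFinP; exact: measurable_funX.
- move=> w Aw /=; rewrite lee_fin -[leRHS]real_normK ?num_real//.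
  by rewrite ler_pXn2r// nnegrE// ltW.
Qed.

(** Weak law of large numbers for the number of pairwise independent events of
   common probability b that occur. *)
Lemma few_successes n (A : 'I_n -> set Omega) (b : R) :
  (0 < n)%N -> 0 < b -> (forall i, measurable (A i)) ->
  (forall i, P (A i) = b%:E) ->
  (forall i j, i != j -> P (A i `&` A j) = (b * b)%:E) ->
  (P [set w | ((\sum_i \1_(A i) w : R) <= n%:R * b / 2)%R] <=
   (4 / (n%:R * b ^+ 2))%:E)%E.
Proof.
move=> n0 b0 mA PA PAA.
have n0' : 0 < n%:R :> R by rewrite ltr0n.
have b1 : b <= 1.
  by rewrite -lee_fin -(PA (Ordinal n0)); exact: probability_le1.
pose f i w : R := \1_(A i) w - b.
have ind01 i w : 0 <= (\1_(A i) w : R) <= 1.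
  by rewrite indicE ler0n/= lern1 leq_b1.
have f1 i w : `|f i w| <= 1.
  by have /andP[? ?] := ind01 i w; rewrite ler_norml /f; lra.
have mind i : measurable_fun setT (\1_(A i) : Omega -> R) by exact: measurable_indic.
have mf i : measurable_fun setT (f i) by apply: measurable_funB.
have iind (B : set Omega) : measurable B ->
    P.-integrable setT (fun w => (\1_B w : R)%:E).
  move=> mB; apply: (integrable_bounded_fun (M := 1)); first exact: probability_le1.
    exact: measurable_indic.
  by move=> w; rewrite indicE ger0_norm// lern1 leq_b1.
have forth i j : i != j -> (\int[P]_w (f i w * f j w)%:E = 0)%E.
  move=> ij.
  have -> : (\int[P]_w (f i w * f j w)%:E =
      \int[P]_w ((\1_(A i `&` A j) w)%:E + (- b)%:E * (\1_(A i) w)%:E +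
                 ((- b)%:E * (\1_(A j) w)%:E + cst (b * b)%:E w)))%E.
    apply: eq_integral => w _; rewrite -!EFinM -!EFinD; congr (_%:E).
    by rewrite indicI /= /f; ring.
  have iZ (B : set Omega) : measurable B ->
      P.-integrable setT (fun w => (- b)%:E * (\1_B w : R)%:E)%E.
    by move=> mB; apply: integrableZl => //; exact: iind.
  have icst : P.-integrable setT (cst (b * b)%:E).
    by apply: finite_measure_integrable_cst.
  rewrite integralD//; last 2 first.
  - by apply: integrableD => //; [apply: iind; exact: measurableI|exact: iZ].
  - by apply: integrableD => //; exact: iZ.
  rewrite integralD//; last 2 first.
  - by apply: iind; exact: measurableI.
  - exact: iZ.
  rewrite integralD//; last exact: iZ.
  rewrite !integralZl//; [|exact: iind|exact: iind].
  rewrite !integral_indic ?setIT//; last exact: measurableI.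
  rewrite integral_cst//= probability_setT mule1 !PA PAA//.
  by rewrite -!EFinM -!EFinD; congr (_%:E); ring.
have eps0 : 0 < n%:R * b / 2 by rewrite divr_gt0// mulr_gt0.
have fn w : \sum_i f i w ^+ 2 <= n%:R.
  rewrite -[X in _ <= X%:R]card_ord -sumr_const; apply: ler_sum => i _.
  by rewrite -[leLHS]real_normK ?num_real// exprn_ile1.
have := chebyshev_orthogonal mf f1 forth fn eps0.
have -> : n%:R / (n%:R * b / 2) ^+ 2 = 4 / (n%:R * b ^+ 2) :> R.
  by field; rewrite !gt_eqF.
apply: le_trans; apply: le_measure; rewrite ?inE.
- by apply: measurable_set_le => //; exact: measurable_sum.
- apply: measurable_set_le => //; apply: measurableT_comp => //; exact: measurable_sum.
move=> w /= h; rewrite /f sumrB sumr_const card_ord -mulr_natl ler0_norm; last first.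
  by rewrite subr_le0 (le_trans h)//; lra.
by lra.
Qed.

End chebyshev.

(** * Random hyperplanes avoid a given point *)

Section almost_sure_nondegeneracy.
Context d (Omega : measurableType d) (R : realType) (P : probability Omega R).
Context (n : nat) (p : 'I_n -> {RV P >-> 'rV[R]_n}) (x : 'rV[R]_n).
Hypothesis prp : product_rule p.
Hypothesis p_ac : forall i B, measurable B -> lebesgue_rV R n B = 0%E ->
  P (p i @^-1` B) = 0%E.

(** Interpolates between the identity (k = 0) and edges x p (k = n). *)
Let hybrid k (w : Omega) : 'M[R]_n :=
  \matrix_(i, j) (if (i < k)%N then (p i w - x) ord0 j else (i == j)%:R).

Let hybrid_at (i0 : 'I_n) (v : 'rV[R]_n) (t : n.-tuple 'rV[R]_n) : 'M[R]_n :=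
  \matrix_(i, j) (if i == i0 then v ord0 j
                  else if (i < i0)%N then (tnth t i - x) ord0 j else (i == j)%:R).

Let cof i0 t : 'rV[R]_n := \row_j cofactor (hybrid_at i0 0 t) i0 j.

Let det_hybrid_at i0 v t : \det (hybrid_at i0 v t) = dot (cof i0 t) v.
Proof.
rewrite (expand_det_row _ i0); apply: eq_bigr => j _.
rewrite !mxE eqxx mulrC; congr (_ * _); rewrite /cofactor; congr (_ * \det _).
by apply/matrixP => k l; rewrite !mxE eq_sym (negbTE (neq_lift _ _)).
Qed.

Let hybridE (i0 : 'I_n) w (v : 'rV[R]_n) :
  (forall j, v ord0 j = hybrid i0.+1 w i0 j) ->
  hybrid i0.+1 w = hybrid_at i0 v (others p i0 0 w).
Proof.
move=> vE; apply/matrixP => i j; rewrite [RHS]mxE.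
have [->|ii0] := eqVneq i i0; first by rewrite vE.
rewrite mxE tnth_mktuple /others_at (negbTE ii0) ltnS leq_eqVlt.
by rewrite (inj_eq val_inj) (negbTE ii0).
Qed.

Let hybrid_nondegenerate k : (k <= n)%N ->
  P.-negligible [set w | \det (hybrid k w) = 0].
Proof.
elim: k => [_|k IHk kn].
  rewrite (_ : [set _ | _] = set0); first exact: negligible_set0.
  apply/seteqP; split => // w /=; rewrite (_ : hybrid 0 w = 1%:M).
    by rewrite det1 => /eqP; rewrite oner_eq0.
  by apply/matrixP => i j; rewrite !mxE.
pose i0 := Ordinal kn.
pose G := [set z : 'rV[R]_n * n.-tuple 'rV[R]_n |
  cof i0 z.2 ord0 i0 != 0 /\ dot (cof i0 z.2) (z.1 - x) = 0].
have mcof : measurable_fun setT (cof i0).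
  apply: measurable_fun_rV => j.
  rewrite (_ : _ \o _ = fun t => (-1) ^+ (i0 + j) *
      \det (row' i0 (col' j (hybrid_at i0 0 t)))); last first.
    by apply/funext => t; rewrite /rV_coord /= mxE.
  apply: measurable_funM; first exact: measurable_cst.
  apply: measurable_fun_det => a b.
  under eq_fun do rewrite !mxE eq_sym (negbTE (neq_lift _ _)).
  case: (lift i0 a < i0)%N; last exact: measurable_cst.
  rewrite (_ : (fun _ => _) =
      fun t => rV_coord (lift j b) (tnth t (lift i0 a)) - x ord0 (lift j b))//.
  apply: measurable_funB; last exact: measurable_cst.
  by apply: (measurableT_comp (measurable_rV_coord _)); exact: measurable_tnth.
have mG : measurable G.
  apply: measurableI.
    rewrite (_ : (fun _ => _) = ~` ((fun z : 'rV[R]_n * n.-tuple 'rV[R]_n =>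
        rV_coord i0 (cof i0 z.2)) @^-1` [set 0])); last first.
      by apply/seteqP; split => z /= /eqP.
    apply: measurableC; apply: measurable_preimage_fun => //.
    apply: (measurableT_comp (measurable_rV_coord _)).
    exact: (measurableT_comp mcof measurable_snd).
  rewrite (_ : (fun _ => _) = (fun z : 'rV[R]_n * n.-tuple 'rV[R]_n =>
      dot (cof i0 z.2) (z.1 - x)) @^-1` [set 0])//.
  apply: measurable_preimage_fun => //; apply: measurable_fun_dot.
    exact: (measurableT_comp mcof measurable_snd).
  exact: (measurableT_comp (measurable_rV_translate (- x)) measurable_fst).
have G0 t : P (p i0 @^-1` [set z | G (z, t)]) = 0%E.
  have mGt : measurable [set z | G (z, t)].
    by have := measurable_ysection t mG; rewrite /ysection;
      congr measurable; apply/seteqP; split => z /=; rewrite inE.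
  apply: p_ac => //.
  have [c0|c0] := eqVneq (cof i0 t ord0 i0) 0.
    rewrite (_ : [set _ | _] = set0) ?measure0//.
    by apply/seteqP; split => // z [/=]; rewrite c0 eqxx.
  have u0 : cof i0 t != 0 by apply: contra c0 => /eqP ->; rewrite mxE.
  rewrite -(lebesgue_rV_hyperplane (dot (cof i0 t) x) u0); congr (lebesgue_rV R n _).
  apply/seteqP; split => z /=; rewrite /G/= dotBr.
    by move=> [_ /eqP]; rewrite subr_eq0 => /eqP.
  by move=> zc; split => //; rewrite [X in X - _]zc subrr.
have := one_and_others_null prp 0 mG G0.
move=> PG; have negG : P.-negligible (one_and_others p i0 0 @^-1` G).
  apply/negligibleP => //.
  exact: (measurable_preimage_fun (measurable_one_and_others _ _ _) mG).
apply: negligibleS (negligibleU (IHk (ltnW kn)) negG) => w /= det0.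
have [|c0] := eqVneq (cof i0 (others p i0 0 w) ord0 i0) 0; [left|right].
  have E : \det (hybrid k w) = cof i0 (others p i0 0 w) ord0 i0.
    rewrite (expand_det_row _ i0) (bigD1 i0)//= big1 ?addr0; last first.
      by move=> j ji0; rewrite mxE ltnn eq_sym (negbTE ji0) mul0r.
    rewrite mxE ltnn eqxx mul1r mxE /cofactor; congr (_ * \det _).
    apply/matrixP => a b; rewrite !mxE [lift _ _ == i0]eq_sym (negbTE (neq_lift _ _)).
    case: ifP => // _.
    by rewrite tnth_mktuple /others_at eq_sym (negbTE (neq_lift _ _)).
  by rewrite E.
split => //=; rewrite -det_hybrid_at -hybridE//.
by move=> j; rewrite [RHS]mxE ltnSn.
Qed.

(** The determinant of a hybrid matrix is a linear form in its last random row.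
   The coefficient on the diagonal is the determinant of the previous hybrid, so
   this form is almost surely nonzero, and its kernel is a hyperplane, which an
   independent random point avoids. *)
Lemma negligible_degenerate :
  P.-negligible [set w | \det (edges x (fun i => p i w)) = 0].
Proof.
have := hybrid_nondegenerate (leqnn n); congr (negligible P _).
apply/seteqP; split => w /=; rewrite (_ : hybrid n w = edges x (p ^~ w))//;
  by apply/matrixP => i j; rewrite !mxE ltn_ord.
Qed.

End almost_sure_nondegeneracy.

(** * Noise averaged over selected indices *)

Section selected_noise.
Context d (Omega : measurableType d) (R : realType) (P : probability Omega R).
Context d1 d2 (T : measurableType d1) (U : measurableType d2) (t0 : T).
Context n (Z : 'I_n -> {RV P >-> T}) (prZ : product_rule Z).
Context (pi : T -> U) (mpi : measurable_fun setT pi).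
Context (xi : T -> R) (K : R).
Hypotheses (mxi : measurable_fun setT xi) (xiK : forall t, `|xi t| <= K).
Hypothesis xi_centered : forall i C, measurable C ->
  (\int[P]_w (\1_C (pi (Z i w)) * xi (Z i w))%:E = 0)%E.

Let observed w : n.-tuple U := [tuple pi (Z l w) | l < n].

Let mobserved : measurable_fun setT observed.
Proof.
apply/measurable_fun_tnthP => i.
rewrite (_ : _ \o _ = pi \o Z i).
  by apply: measurableT_comp.
by apply/funext => w /=; rewrite tnth_mktuple.
Qed.

(** Integrate first over the pair i, the others being fixed: the selection then
   depends on that pair through its observed part only. *)
Lemma selected_noise_orthogonal (G : set (n.-tuple U)) i j :
  measurable G -> i != j ->
  (\int[P]_w (\1_G (observed w) * xi (Z i w) * xi (Z j w))%:E = 0)%E.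
Proof.
move=> mG ij.
pose repl (z : T * n.-tuple T) : n.-tuple U :=
  [tuple if l == i then pi z.1 else pi (tnth z.2 l) | l < n].
pose F (z : T * n.-tuple T) : R :=
  \1_G (repl z) * xi z.1 * xi (tnth z.2 j).
have mrepl : measurable_fun setT repl.
  apply/measurable_fun_tnthP => l.
  rewrite (_ : _ \o _ = fun z => if l == i then pi z.1 else pi (tnth z.2 l)).
    case: (l == i); first exact: (measurableT_comp mpi measurable_fst).
    by apply: (measurableT_comp mpi); apply: (measurableT_comp (measurable_tnth l)).
  by apply/funext => z /=; rewrite tnth_mktuple.
have mF : measurable_fun setT F.
  apply: measurable_funM.
    apply: measurable_funM; last exact: (measurableT_comp mxi measurable_fst).
    by apply: measurableT_comp mrepl; exact: measurable_indic.
  by apply: (measurableT_comp mxi); apply: (measurableT_comp (measurable_tnth j)).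
have FK z : `|F z| <= K * K.
  rewrite !normrM -mulrA -[leRHS]mul1r; apply: ler_pM; rewrite ?mulr_ge0//.
    by rewrite indicE normr_nat lern1 leq_b1.
  by apply: ler_pM.
have F0 t : (\int[P]_w (F (Z i w, t))%:E = 0)%E.
  pose C := (fun u : U =>
    [tuple if l == i then u else pi (tnth t l) | l < n] : n.-tuple U) @^-1` G.
  have mC : measurable C.
    apply: measurable_preimage_fun => //; apply/measurable_fun_tnthP => l.
    rewrite (_ : _ \o _ = fun u => if l == i then u else pi (tnth t l)).
      by case: (l == i) => //; exact: measurable_cst.
    by apply/funext => u /=; rewrite tnth_mktuple.
  have E w : (F (Z i w, t))%:E =
      ((xi (tnth t j))%:E * (\1_C (pi (Z i w)) * xi (Z i w))%:E)%E.
    by rewrite -EFinM /F mulrC.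
  under eq_integral do rewrite E.
  rewrite integralZl// ?xi_centered ?mule0//.
  apply: (integrable_bounded_fun (M := 1 * K)); first exact: probability_le1.
    apply: measurable_funM; last by apply: measurableT_comp.
    apply: measurableT_comp; first exact: measurable_indic.
    by apply: measurableT_comp.
  move=> w; rewrite normrM; apply: ler_pM => //.
  by rewrite indicE normr_nat lern1 leq_b1.
have := one_and_others_integral0 prZ t0 mF FK F0; rewrite /F => <-.
apply: eq_integral => w _; congr (_%:E); rewrite /one_and_others /=.
congr (\1_G _ * _ * xi _).
  apply: eq_from_tnth => l; rewrite !tnth_mktuple /others_at.
  by have [->|//] := eqVneq l i.
by rewrite tnth_mktuple /others_at eq_sym (negbTE ij).
Qed.

Lemma selected_noise_small (G : 'I_n -> set (n.-tuple U)) (k : nat) (eps : R) :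
  (forall i, measurable (G i)) -> (forall t, \sum_i \1_(G i) t <= k%:R :> R) ->
  0 < eps ->
  (P [set w | (eps <= `|\sum_i \1_(G i) (observed w) * xi (Z i w)|)%R] <=
   (K ^+ 2 * k%:R / eps ^+ 2)%:E)%E.
Proof.
move=> mG Gk eps0.
have ind1 i t : `|\1_(G i) t : R| <= 1 by rewrite indicE normr_nat lern1 leq_b1.
apply: (chebyshev_orthogonal (M := 1 * K)) => //.
- move=> i; apply: measurable_funM; last by apply: measurableT_comp.
  by apply: measurableT_comp mobserved; exact: measurable_indic.
- by move=> i w; rewrite normrM; apply: ler_pM.
- move=> i j ij.
  rewrite -(selected_noise_orthogonal (measurableI _ _ (mG i) (mG j)) ij).
  by apply: eq_integral => w _; congr (_%:E); rewrite indicI /=; ring.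
- move=> w; apply: (@le_trans _ _ (\sum_i K ^+ 2 * \1_(G i) (observed w))).
    apply: ler_sum => i _; rewrite exprMn mulrC; apply: ler_pM; rewrite ?sqr_ge0//.
      rewrite -[leLHS]real_normK ?num_real// ler_pXn2r ?nnegrE//.
      by apply: le_trans (xiK (Z i w)).
    by rewrite indicE; case: (_ \in _); rewrite ?expr1n ?expr0n.
  by rewrite -mulr_sumr ler_wpM2l ?sqr_ge0.
Qed.

End selected_noise.

Section regression_noise.
Context d (Omega : measurableType d) (R : realType) (P : probability Omega R).
Context n (X : {RV P >-> 'rV[R]_n}) (Y : {RV P >-> R}).
Context (r : 'rV[R]_n -> R) (hr : regression_function X Y r).
Context (M : R) (YM : {ae P, forall w, `|Y w| <= M}).
Context (D : set 'rV[R]_n) (mD : measurable D).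
Context (L : R) (rL : forall x, D x -> `|r x| <= L).

(** The noise, truncated so as to be bounded everywhere. *)
Definition noise (z : 'rV[R]_n * R) : R :=
  \1_D z.1 * \1_[set y : R | `|y| <= M] z.2 * (z.2 - r z.1).

Lemma measurable_noise : measurable_fun setT noise.
Proof.
have [mr _ _] := hr.
apply: measurable_funM; last first.
  by apply: measurable_funB => //; exact: (measurableT_comp mr measurable_fst).
apply: measurable_funM.
  by apply: measurableT_comp => //; exact: measurable_indic.
have mI : measurable [set y : R | `|y| <= M].
  by apply: measurable_set_le => //; exact: measurable_cst.
exact: (measurableT_comp (measurable_indic mI) measurable_snd).
Qed.

Lemma noise_bounded z : 0 <= M -> 0 <= L -> `|noise z| <= M + L.
Proof.
move=> M0 L0; rewrite /noise !indicE.
case: (boolP (z.1 \in D)) => [|_]; last by rewrite !mul0r normr0 addr_ge0.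
rewrite inE => Dz; case: (boolP (_ \in _)) => [|_]; last first.
  by rewrite mulr0 mul0r normr0 addr_ge0.
rewrite inE /= => zM.
rewrite !mul1r (le_trans (ler_normB _ _))// lerD//.
exact: rL.
Qed.

(** Up to a null event the truncation only restricts to X in D, so that this is
   the defining property of the regression function on the set C `&` D. *)
Lemma noise_centered C : measurable C -> 0 <= M -> 0 <= L ->
  (\int[P]_w (\1_C (X w) * noise (X w, Y w))%:E = 0)%E.
Proof.
move=> mC M0 L0; have [mr ir rY] := hr.
have mXCD : measurable (X @^-1` (C `&` D)).
  by apply: measurable_preimage_fun => //; exact: measurableI.
have mnoise := measurable_noise.
have mXY : measurable_fun setT (fun w => (X w, Y w)).
  by apply/measurable_fun_pairP; split; exact: measurable_funP.
have mrX : measurable_fun setT (r \o X) by exact: measurableT_comp.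
have mE : measurable_fun setT (fun w => \1_C (X w) * noise (X w, Y w)).
  apply: measurable_funM; last by apply: measurableT_comp.
  by apply: measurableT_comp => //; exact: measurable_indic.
pose Y' w : R := Y w * \1_[set y : R | `|y| <= M] (Y w).
have mI : measurable [set y : R | `|y| <= M].
  by apply: measurable_set_le => //; exact: measurable_cst.
have mY' : measurable_fun setT Y'.
  by apply: measurable_funM => //; apply: (measurableT_comp (measurable_indic mI)).
have Y'M w : `|Y' w| <= M.
  rewrite /Y' indicE; case: (boolP (_ \in _)) => [|_].
    by rewrite inE mulr1.
  by rewrite mulr0 normr0.
have Y'Y : {ae P, forall w, Y' w = Y w}.
  apply: filterS YM => w YwM; rewrite /Y' indicE.
  by rewrite (_ : _ \in _) ?mulr1// inE.
transitivity (\int[P]_(w in X @^-1` (C `&` D)) ((Y' w)%:E - (r (X w))%:E))%E.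
  rewrite [RHS]integral_mkcond; apply: ae_eq_integral => //.
  - exact/measurable_EFinP.
  - apply: (measurable_restrictT _ mXCD).1; apply: measurable_funTS.
    have : measurable_fun setT (EFin \o (fun w => Y' w - r (X w))); last by [].
    by apply/measurable_EFinP; exact: measurable_funB.
  - apply: filterS YM => w YwM _; rewrite /patch /noise /Y' !indicE/=.
    have -> : Y w \in [set y : R | `|y| <= M] by rewrite inE.
    rewrite !mulr1 mulrA -natrM mulnb -EFinB.
    have -> : (X w \in C) && (X w \in D) = (w \in X @^-1` (C `&` D)).
      by apply/andP/idP; rewrite !inE.
    by case: ifP => _; rewrite ?mul1r ?mul0r.
have iY' : P.-integrable (X @^-1` (C `&` D)) (EFin \o Y').
  apply: (integrableS measurableT) => //.
  by apply: (integrable_bounded_fun (M := M)) => //; exact: probability_le1.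
have irX : P.-integrable (X @^-1` (C `&` D)) (EFin \o (r \o X)).
  apply: measurable_bounded_integrable => //.
  - by apply: (@le_lt_trans _ _ 1%E); [exact: probability_le1|exact: ltry].
  - exact: measurable_funTS.
  - exists L; split; first exact: num_real.
    by move=> N LN w [_ Dw] /=; rewrite (le_trans (rL Dw))// ltW.
rewrite (integralB_EFin mXCD iY' irX).
have -> : (\int[P]_(w in X @^-1` (C `&` D)) (EFin \o Y') w =
    \int[P]_(w in X @^-1` (C `&` D)) (Y w)%:E)%E.
  apply: ae_eq_integral => //.
  - by apply: measurable_funTS; exact/measurable_EFinP.
  - by apply: measurable_funTS; exact/measurable_EFinP.
  - by apply: filterS Y'Y => w /= -> _.
rewrite -rY; last exact: measurableI.
rewrite (integral_pushforward (measurable_funP X) (f := EFin \o r)) //.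
- by rewrite subee// integrable_fin_num.
- exact/measurable_EFinP.
- exact: measurableI.
Qed.

End regression_noise.

(** * Measurability of the neighbour selection *)

Lemma measurable_fin_exists d (T : measurableType d) (I : finType)
    (A : I -> set T) :
  (forall i, measurable (A i)) -> measurable [set x | exists i, A i x].
Proof.
move=> mA; rewrite (_ : [set _ | _] = ~` [set x | forall i, (~` A i) x]).
  by apply/measurableC/measurable_fin_forall => i; exact: measurableC.
apply/seteqP; split => x /= => [[i Ai] h|h]; first exact: (h i).
by apply/not_existsP => h'; apply: h => i; exact: h'.
Qed.

(** A table takes finitely many values. *)
Lemma measurable_table_event d (T : measurableType d) (I J : finType)
    (c : T -> I -> J -> bool) (F : (I -> J -> bool) -> bool) :
  (forall i j, measurable [set t | c t i j]) -> measurable [set t | F (c t)].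
Proof.
move=> mc.
rewrite (_ : [set _ | _] = [set t | exists v : {ffun I * J -> bool},
    F (fun i j => v (i, j)) /\ forall ij, c t ij.1 ij.2 = v ij]).
  apply: measurable_fin_exists => v.
  case: (boolP (F (fun i j => v (i, j)))) => Fv; last first.
    by rewrite (_ : (fun _ => _) = set0)//; apply/seteqP; split => // t [].
  rewrite (_ : (fun _ => _) = [set t | forall ij, c t ij.1 ij.2 = v ij]); last first.
    by apply/seteqP; split => t /=; [case|split].
  apply: measurable_fin_forall => ij; case: (v ij); first exact: mc.
  rewrite (_ : (fun _ => _) = ~` [set t | c t ij.1 ij.2]).
    exact/measurableC/mc.
  by apply/seteqP; split => t /=; [move=> -> | move/negP/negbTE].
apply/seteqP; split => t /=.
  move=> Fc; exists [ffun ij => c t ij.1 ij.2]; split; last by move=> ij; rewrite ffunE.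
  rewrite (_ : (fun i j => _) = c t)//.
  by apply/funext => i; apply/funext => j; rewrite ffunE.
move=> [v [Fv cv]]; rewrite (_ : c t = (fun i j => v (i, j)))//.
by apply/funext => i; apply/funext => j; rewrite -cv.
Qed.

Section measurable_table.
Context d' (T : measurableType d') (R : realType) (d n : nat).
Context (x : 'rV[R]_d) (pts : T -> 'I_n -> 'rV[R]_d).
Hypothesis mpts : forall j, measurable_fun setT (fun t => pts t j).

Lemma measurable_facet_points (S : {set 'I_n}) i :
  measurable_fun setT (fun t => facet_points (d := d) (pts t) S i).
Proof.
rewrite /facet_points; have [iS|iS] := ltnP i (size (enum S)); last first.
  rewrite (_ : (fun _ => _) = cst 0); first exact: measurable_cst.
  by apply/funext => t; rewrite nth_default// size_map.
case: (enum S) iS => // j0 s iS.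
rewrite (_ : (fun _ => _) = fun t => pts t (nth j0 (j0 :: s) i)); first exact: mpts.
by apply/funext => t; rewrite (nth_map j0).
Qed.

Lemma measurable_normal_facet (S : {set 'I_n}) :
  measurable_fun setT (fun t => normal x (facet_points (d := d) (pts t) S)).
Proof. by apply: measurable_normal => i; exact: measurable_facet_points. Qed.

Lemma measurable_cross_table S j :
  measurable [set t | cross_table (pts t) x S j].
Proof.
apply: measurable_set_le; first exact: measurable_cst.
apply: measurable_fun_dot; last exact: measurable_normal_facet.
by apply: (measurableT_comp (measurable_rV_translate (- x))); exact: mpts.
Qed.

Lemma measurable_neighbour k i :
  measurable [set t | neighbour d (cross_table (pts t) x) k i].
Proof.
apply: (measurable_table_event (c := fun t => cross_table (pts t) x)
  (fun c => neighbour d c k i)).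
exact: measurable_cross_table.
Qed.

End measurable_table.

(** * Integrals of functions that need not be measurable *)

Section lower_integral.
Context d (Omega : measurableType d) (R : realType) (P : probability Omega R).

(** The integral of a nonnegative function is a supremum over the simple
   functions below it, even when the function is not measurable. *)
Lemma le_integral_ge0 (f g : Omega -> \bar R) :
  (forall w, 0 <= f w)%E -> (forall w, f w <= g w)%E ->
  (\int[P]_w f w <= \int[P]_w g w)%E.
Proof.
move=> f0 fg; rewrite !ge0_integralTE//; last first.
  by move=> w; apply: le_trans (f0 w) (fg w).
apply: le_ereal_sup => _ [h hf <-]; exists h => // w.
exact: le_trans (hf w) (fg w).
Qed.

Lemma integral_le_exceptional (f : Omega -> R) (a L : R) (B N : set Omega) :
  (forall w, 0 <= f w) -> 0 <= a -> 0 <= L -> measurable B -> P.-negligible N ->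
  (forall w, ~ N w -> ~ B w -> f w <= a) -> (forall w, ~ N w -> f w <= L) ->
  (\int[P]_w (f w)%:E <= a%:E + L%:E * P B)%E.
Proof.
move=> f0 a0 L0 mB [N' [mN' N'0 NN']] fa fL.
(* infinite on a null set, which costs nothing *)
pose g w : \bar R := (a%:E + L%:E * (\1_B w)%:E + +oo * (\1_N' w)%:E)%E.
have mind (A : set Omega) : measurable A ->
    measurable_fun setT (fun w => (\1_A w : R)%:E).
  by move=> mA; apply/measurable_EFinP; exact: measurable_indic.
have ind0 (A : set Omega) w : (0 <= (\1_A w : R)%:E)%E by rewrite lee_fin.
apply: (@le_trans _ _ (\int[P]_w g w)%E).
  apply: le_integral_ge0 => w; first by rewrite lee_fin.
  rewrite /g; have [wN|wN] := pselect (N' w).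
    by rewrite [\1_N' w]indicE mem_set// mule1 addey ?leey.
  have Nw : ~ N w by apply: contra_not wN; exact: NN'.
  rewrite [\1_N' w]indicE memNset// mule0 adde0 -EFinM -EFinD lee_fin indicE.
  have [wB|wB] := boolP (w \in B); first by rewrite mulr1 (le_trans (fL _ Nw))// lerDr.
  by rewrite mulr0 addr0; apply: fa => //; rewrite -notin_setE.
have mLB : measurable_fun setT (fun w => L%:E * (\1_B w : R)%:E)%E.
  by apply: measurable_funeM; exact: mind.
have myN : measurable_fun setT (fun w => +oo * (\1_N' w : R)%:E)%E.
  by apply: measurable_funeM; exact: mind.
have LB0 w : (0 <= L%:E * (\1_B w : R)%:E)%E by exact: mule_ge0.
have yN0 w : (0 <= +oo * (\1_N' w : R)%:E)%E by exact: mule_ge0.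
rewrite ge0_integralD//; last 2 first.
- by move=> w _; apply: adde_ge0; [rewrite lee_fin|exact: LB0].
- by apply: emeasurable_funD => //; exact: measurable_cst.
rewrite ge0_integralD//.
rewrite integral_cst//= probability_setT mule1 !ge0_integralZl//; try exact: mind.
have -> : (\int[P]_w (\1_N' w)%:E = 0)%E by rewrite integral_indic// setIT.
by rewrite mule0 adde0 integral_indic// setIT.
Qed.

End lower_integral.

(** * Tails, counts and unions of events *)

Section event_bounds.
Context d (Omega : measurableType d) (R : realType) (P : probability Omega R).

Lemma probability_tail_small (f : Omega -> R) (eps : R) :
  measurable_fun setT f -> 0 < eps ->
  exists m : nat, (P [set w | (m.+1%:R <= f w)%R] <= eps%:E)%E.
Proof.
move=> mf eps0; pose F (m : nat) := [set w | m%:R <= f w].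
have mF m : measurable (F m) by apply: measurable_set_le => //; exact: measurable_cst.
have F0 : \bigcap_m F m = set0.
  apply/seteqP; split => // w /(_ (Num.trunc (f w)).+1 I).
  by rewrite /F/= leNgt truncnS_gt.
have : (P \o F) x @[x --> \oo] --> P (\bigcap_m F m).
  apply: nonincreasing_cvg_mu => //.
  - by apply: (@le_lt_trans _ _ 1%E); [exact: probability_le1|exact: ltry].
  - by rewrite F0.
  - move=> m m' mm'; apply/subsetPset => w /=; apply: le_trans.
    by rewrite ler_nat.
rewrite F0 measure0 => /fine_cvgP[_] /cvgrPdist_le /(_ eps eps0) [m _ /(_ m.+1)] /=.
rewrite leqnSn => /(_ isT); rewrite sub0r normrN ger0_norm ?fine_ge0// => h.
have Pfin : P (F m.+1) \is a fin_num by exact: fin_num_measure.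
by exists m; rewrite -/(F m.+1) -(fineK Pfin) lee_fin.
Qed.

Lemma measurable_event_count (I : finType) (Q : pred I) (E : I -> set Omega) :
  (forall i, measurable (E i)) ->
  measurable_fun setT (fun w => \sum_(i | Q i) (\1_(E i) w : R)).
Proof.
move=> mE; rewrite (_ : (fun _ => _) = fun w => \sum_(i <- enum Q) (\1_(E i) w : R)).
  by apply: measurable_sum => i; exact: measurable_indic.
by apply/funext => w; rewrite big_enum.
Qed.

Lemma markov_count (I : finType) (Q : pred I) (E : I -> set Omega) (q tau : R) :
  (forall i, measurable (E i)) -> (forall i, Q i -> P (E i) <= q%:E)%E -> 0 < tau ->
  (P [set w | (tau <= \sum_(i | Q i) (\1_(E i) w : R))%R] <=
   (#|Q|%:R * q / tau)%:E)%E.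
Proof.
move=> mE Eq tau0.
pose N w : R := \sum_(i | Q i) \1_(E i) w.
have mN : measurable_fun setT N by exact: measurable_event_count.
have N0 w : 0 <= N w by apply: sumr_ge0.
pose A := [set w | tau <= N w].
have mA : measurable A.
  by apply: measurable_set_le => //; exact: measurable_cst.
rewrite -/A EFinM lee_pdivlMr//.
apply: (@le_trans _ _ (\int[P]_w (N w)%:E)%E).
  rewrite muleC -integral_cst//.
  apply: (@le_trans _ _ (\int[P]_(w in A) (N w)%:E)%E).
    apply: ge0_le_integral => //.
    - by move=> w _ /=; rewrite lee_fin ltW.
    - by apply: measurable_funTS; apply/measurable_EFinP.
  apply: ge0_subset_integral => //; first by apply/measurable_EFinP.
  by move=> w _; rewrite lee_fin.
have -> : (\int[P]_w (N w)%:E = \sum_(i <- enum Q) P (E i))%E.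
  under eq_integral do rewrite /N -big_enum -sumEFin.
  rewrite ge0_integral_sum//.
  - by apply: eq_bigr => i _; rewrite integral_indic// setIT.
  - by move=> i; apply/measurable_EFinP; exact: measurable_indic.
rewrite big_enum/=; apply: le_trans (lee_sum _ Eq) _.
by rewrite sumEFin lee_fin sumr_const mulr_natl.
Qed.

Lemma probability_fin_exists_le n (A : 'I_n -> set Omega) :
  (forall i, measurable (A i)) ->
  (P [set w | exists i, A i w] <= \sum_(i < n) P (A i))%E.
Proof.
move=> mA; pose F k := if insub k is Some i then A i else set0.
have FE (i : 'I_n) : F i = A i by rewrite /F valK.
under eq_bigr do rewrite -FE.
apply: (@content_subadditive _ _ _ P _ F n).
- by move=> k _; rewrite /F; case: insub.
- exact: measurable_fin_exists.
- move=> w [i Ai]; rewrite -bigcup_mkord; exists i => //=.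
  by rewrite FE.
Qed.

End event_bounds.

Lemma card_draws_le n d : (#|[pred S : {set 'I_n} | #|S| == d]| <= n ^ d)%N.
Proof.
have -> : #|[pred S : {set 'I_n} | #|S| == d]| = 'C(n, d).
  by rewrite -[in RHS](card_ord n) -card_draws; apply: eq_card => S; rewrite !inE.
apply: (@leq_trans (n ^_ d)).
  by rewrite -bin_ffact leq_pmulr// fact_gt0.
rewrite ffact_prod -[in X in (_ <= X)%N](card_ord d) -prod_nat_const.
by apply: leq_prod => i _; exact: leq_subr.
Qed.

(** A far neighbour would have a count at least as large as the product of the
   numbers of points in the cones divided by n, while k points at distance at most
   eta have smaller counts. *)
Lemma neighbours_are_close (R : realType) (d n : nat) (d_gt0 : (0 < d)%N)
    (pts : 'I_n -> 'rV[R]_d) (x : 'rV[R]_d) (delta eta : R) (k : nat) (i : 'I_n) :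
  general_position pts x -> 0 < eta ->
  (k <= #|[set j | `[< forall m, (`|(pts j - x) ord0 m| <= eta)%R >] ]%SET|)%N ->
  (n * (\sum_(S : {set 'I_n} | #|S| == d)
      (eta^-1 <= \sum_m `|normal x (facet_points pts S) ord0 m|)%R) <
   \prod_(l < d.+1)
      #|[set j | `[< facing_cone d_gt0 delta l (pts j - x)%R >] ]%SET|)%N ->
  neighbour d (cross_table pts x) k i ->
  forall m, `|(pts i - x) ord0 m| <= 2 * delta.
Proof.
move=> nd eta0 kB; set T := (\sum_(S | _) _)%N => TN iN m.
rewrite leNgt; apply/negP => far.
have := far_point_count d_gt0 nd far.
have : (table_count d (cross_table pts x) i < T.+1)%N.
  apply: neighbour_count_lt kB _ iN => j; rewrite inE ltnS => /asboolP jeta.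
  exact: near_point_count.
rewrite ltnS /table_count /cross_table => iT h.
have := leq_trans h (leq_mul (leqnn n) iT).
by rewrite leqNgt TN.
Qed.

(** * Events of the sample *)

Section pair.
Context d (Omega : measurableType d) (R : realType) (P : probability Omega R).
Context d1 d2 (T1 : measurableType d1) (T2 : measurableType d2).

Definition pair_of (X : {RV P >-> T1}) (Y : {RV P >-> T2}) (w : Omega) : T1 * T2 :=
  (X w, Y w).

Lemma measurable_pair_of X Y : measurable_fun setT (pair_of X Y).
Proof. by apply/measurable_fun_pairP; split; exact: measurable_funP. Qed.

HB.instance Definition _ X Y :=
  isMeasurableFun.Build _ _ _ _ (pair_of X Y) (measurable_pair_of X Y).

End pair.

Section sample.
Context (R : realType) (d : nat) (d_gt0 : (0 < d)%N).
Context disp (Omega : measurableType disp) (P : probability Omega R).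
Context (X : {RV P >-> 'rV[R]_d}) (Y : {RV P >-> R}).
Context (X_ : nat -> {RV P >-> 'rV[R]_d}) (Y_ : nat -> {RV P >-> R}).
Hypothesis hdist : forall i, identically_distributed P
  (fun w => (X_ i w, Y_ i w)) (fun w => (X w, Y w)).
Hypothesis hindep : mutually_independent P
  (fun (o : option nat) w =>
     if o is Some i then (X_ i w, Y_ i w) else (X w, Y w)).
Hypothesis hdens : has_density X.

Lemma sample_law i B : measurable B -> P (X_ i @^-1` B) = P (X @^-1` B).
Proof.
move=> mB; have := hdist i (B := fst @^-1` B); apply.
exact: measurable_preimage_fun measurable_fst mB.
Qed.

Lemma pairs_product_rule n (s : 'I_n -> nat) : injective s ->
  product_rule (fun i =>
    pair_of (X_ (s i)) (Y_ (s i)) : {RV P >-> ('rV[R]_d * R)%type}).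
Proof.
move=> sinj; apply: (mutually_independent_product_rule (s := Some \o s) hindep) => //.
by move=> i j [/sinj].
Qed.

Lemma points_product_rule n (s : 'I_n -> nat) : injective s ->
  product_rule (fun i => X_ (s i)).
Proof.
move=> sinj B mB.
have := pairs_product_rule sinj (B := fun i => fst @^-1` (B i)); apply=> i.
exact: measurable_preimage_fun measurable_fst (mB i).
Qed.

Lemma density_absolutely_continuous B :
  measurable B -> lebesgue_rV R d B = 0%E -> P (X @^-1` B) = 0%E.
Proof.
move=> mB B0; have [f [mf _ fE]] := hdens.
rewrite -[LHS]/(distribution P X B) fE//; apply: null_set_integral => //.
by apply: measurable_funTS; exact/measurable_EFinP.
Qed.

Definition sample n w (i : 'I_n) : 'rV[R]_d := X_ i w.

Section facets.
Context (x : 'rV[R]_d).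

Lemma facet_pointsE n (S : {set 'I_n}) : #|S| = d ->
  exists s : 'I_d -> nat, injective s /\
    forall w, facet_points (sample w) S = (fun i => X_ (s i) w).
Proof.
move=> Sd; have sz (i : 'I_d) : (i < size (enum S))%N by rewrite -cardE Sd.
exists (fun i => nth 0%N (map val (enum S)) i); split.
  have U : uniq (map val (enum S)).
    by rewrite map_inj_uniq ?enum_uniq//; exact: val_inj.
  by move=> i j /eqP; rewrite nth_uniq ?size_map// => /eqP/val_inj.
move=> w; apply/funext => i; rewrite /facet_points.
case: (enum S) (sz i) => // j0 e ie.
by rewrite (nth_map j0)// (nth_map j0).
Qed.

Lemma sample_general_position n :
  P.-negligible [set w | ~ general_position (@sample n w) x].
Proof.
apply: (negligibleS _ (negligible_fin_exists
  (A := fun S : {set 'I_n} => [set w | #|S| = d /\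
    \det (edges x (facet_points (sample w) S)) = 0]) _)).
  move=> w /= /existsNP[S] /not_implyP[Sd /negP/negPn/eqP S0].
  by exists S.
move=> S; have [Sd|Sd] := eqVneq #|S| d; last first.
  rewrite (_ : [set _ | _] = set0); first exact: negligible_set0.
  by apply/seteqP; split => // w [/eqP]; rewrite (negbTE Sd).
have [s [sinj sE]] := facet_pointsE Sd.
apply: (negligibleS _ (negligible_degenerate x (points_product_rule sinj) _)).
  by move=> w /= [_]; rewrite sE.
by move=> i B mB B0; rewrite sample_law// density_absolutely_continuous.
Qed.

(** The inverse of the sup-norm distance from x to the hyperplane, when this
   hyperplane avoids x. *)
Definition steepness (q : 'I_d -> 'rV[R]_d) : R := \sum_j `|normal x q ord0 j|.

Definition steep_facet n (m : R) (S : {set 'I_n}) : set Omega :=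
  [set w | m <= steepness (facet_points (sample w) S)].

Lemma measurable_steepness d' (T : measurableType d') (q : T -> 'I_d -> 'rV[R]_d) :
  (forall i, measurable_fun setT (fun t => q t i)) ->
  measurable_fun setT (fun t => steepness (q t)).
Proof.
move=> mq; apply: measurable_sum => j; apply: measurableT_comp => //.
by apply: (measurableT_comp (measurable_rV_coord j)); exact: measurable_normal.
Qed.

Lemma measurable_steep_facet n m (S : {set 'I_n}) : measurable (steep_facet m S).
Proof.
apply: measurable_set_le; first exact: measurable_cst.
apply: measurable_steepness => i; apply: measurable_facet_points => j.
exact: measurable_funP.
Qed.

Lemma steep_facet_law n m (S : {set 'I_n}) : #|S| = d ->
  P (steep_facet m S) = P [set w | m <= steepness (fun i => X_ i w)]%R.
Proof.
move=> Sd; have [s [sinj sE]] := facet_pointsE Sd.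
pose A := [set t : d.-tuple 'rV[R]_d | m <= steepness (tnth t)].
have mA : measurable A.
  apply: measurable_set_le; first exact: measurable_cst.
  by apply: measurable_steepness => i; exact: measurable_tnth.
have AE (V : 'I_d -> {RV P >-> 'rV[R]_d}) :
    [set w | m <= steepness (fun i => V i w)] = tuple_of V @^-1` A.
  apply/seteqP; split => w /=; rewrite /A/=;
  by congr (_ <= steepness _); apply/funext => i; rewrite tnth_mktuple.
rewrite /steep_facet; under eq_set do rewrite sE.
rewrite (AE (fun i => X_ (s i))) (AE (fun i : 'I_d => X_ i)).
apply: eq_joint_law => //.
- exact: points_product_rule.
- by apply: (points_product_rule (s := val)); exact: val_inj.
- by move=> i B mB; rewrite !sample_law.
Qed.

End facets.

Lemma few_sample_points n (B : set 'rV[R]_d) (b : R) :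
  (0 < n)%N -> measurable B -> P (X @^-1` B) = b%:E -> 0 < b ->
  (P [set w | ((\sum_(i < n) \1_(X_ i @^-1` B) w : R) <= n%:R * b / 2)%R] <=
   (4 / (n%:R * b ^+ 2))%:E)%E.
Proof.
move=> n0 mB Bb b0; apply: few_successes => //.
- by move=> i; apply: measurable_preimage_fun.
- by move=> i; rewrite sample_law.
move=> i j ij.
have := points_product_rule (s := val) (@val_inj _ _ 'I_n)
  (B := fun l => if (l == i) || (l == j) then B else setT).
have -> : [set w | forall l : 'I_n,
      (if (l == i) || (l == j) then B else setT) (X_ (val l) w)] =
    X_ i @^-1` B `&` X_ j @^-1` B.
  apply/seteqP; split => w /= => [h|[hi hj] l].
    by split; [have := h i|have := h j]; rewrite eqxx ?orbT.
  by have [->|] := eqVneq l i => //=; have [->|] := eqVneq l j.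
move=> ->; last by move=> l; case: ifP.
rewrite (bigD1 i)//= (bigD1 j)/=; last by rewrite eq_sym.
rewrite !eqxx orbT big1 => [|l /andP[/negbTE -> /negbTE ->]]; last first.
  by rewrite preimage_setT probability_setT.
by rewrite mule1 !sample_law// Bb -EFinM.
Qed.

Section regression.
Context (M : R) (M0 : 0 <= M) (YM : {ae P, forall w, `|Y w| <= M}).
Context (r : 'rV[R]_d -> R) (hr : regression_function X Y r).

Lemma sample_bounded i : P.-negligible [set w | ~ `|Y_ i w| <= M].
Proof.
have mI : measurable [set y : R | `|y| <= M].
  by apply: measurable_set_le => //; exact: measurable_cst.
have mB : measurable (snd @^-1` (~` [set y : R | `|y| <= M]) : set ('rV[R]_d * R)).
  by apply: (measurable_preimage_fun measurable_snd); exact: measurableC.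
apply/negligibleP.
  by apply: (measurable_preimage_fun (measurable_funP (Y_ i)) (measurableC mI)).
rewrite -[LHS]/(P ((fun w => (X_ i w, Y_ i w)) @^-1`
  (snd @^-1` (~` [set y : R | `|y| <= M])))) hdist//.
apply: measure_negligible YM.
exact: (measurable_preimage_fun (measurable_funP Y) (measurableC mI)).
Qed.

Section at_point.
Context (x : 'rV[R]_d) (D : set 'rV[R]_d) (mD : measurable D).
Context (L : R) (L0 : 0 <= L) (rL : forall y, D y -> `|r y| <= L).

Lemma sample_noise_centered i C : measurable C ->
  (\int[P]_w (\1_C (X_ i w) * noise r M D (X_ i w, Y_ i w))%:E = 0)%E.
Proof.
move=> mC; rewrite -(noise_centered hr YM mD rL mC M0 L0).
pose h (z : 'rV[R]_d * R) : R := \1_C z.1 * noise r M D z.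
have mh : measurable_fun setT h.
  apply: measurable_funM; last exact: (measurable_noise hr).
  by apply: measurableT_comp => //; exact: measurable_indic.
have lawE (V : {RV P >-> 'rV[R]_d}) (W : {RV P >-> R}) :
    (\int[P]_w (h (V w, W w))%:E = \int[distribution P (pair_of V W)]_z (h z)%:E)%E.
  rewrite (@integral_distribution _ _ _ _ _ P (pair_of V W) (EFin \o h))//.
    exact/measurable_EFinP.
  apply: (integrable_bounded_fun (M := 1 * (M + L))); first exact: probability_le1.
    by apply: measurableT_comp => //; exact: measurable_pair_of.
  move=> w; rewrite normrM; apply: ler_pM => //; last exact: noise_bounded.
  by rewrite indicE normr_nat lern1 leq_b1.
rewrite (lawE (X_ i) (Y_ i)) (lawE X Y).
by apply: eq_measure_integral => A mA _; exact: hdist.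
Qed.

Lemma neighbour_noise_small n k (eps : R) : (0 < k)%N -> 0 < eps ->
  (P [set w | (k%:R * eps <= `|\sum_(i < n)
       (neighbour d (cross_table (fun i : 'I_n => X_ i w) x) k i)%:R *
       noise r M D (X_ i w, Y_ i w)|)%R] <=
   ((M + L) ^+ 2 / (k%:R * eps ^+ 2))%:E)%E.
Proof.
move=> k0 eps0.
pose G (i : 'I_n) := [set t : n.-tuple 'rV[R]_d |
  neighbour d (cross_table (tnth t) x) k i].
have mG i : measurable (G i).
  by apply: measurable_neighbour => j; exact: measurable_tnth.
have Gk t : \sum_i \1_(G i) t <= k%:R :> R.
  under eq_bigr do rewrite indicE.
  rewrite -natr_sum ler_nat (eq_bigr (fun i =>
      (i \in take k (table_order d (cross_table (tnth t) x)) : nat))); last first.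
    by move=> i _; congr nat_of_bool; apply/idP/idP; rewrite inE.
  rewrite -big_mkcond/= sum1_card (card_uniqP _) ?take_uniq ?table_order_uniq//.
  by rewrite size_take_min geq_minl.
have keps0 : 0 < k%:R * eps by rewrite mulr_gt0// ltr0n.
have := @selected_noise_small _ _ _ P _ _ ('rV[R]_d * R)%type 'rV[R]_d (0, 0) n _
  (pairs_product_rule (s := val) (@val_inj _ _ 'I_n))
  fst measurable_fst (noise r M D) (M + L) (measurable_noise hr M mD)
  (fun z => noise_bounded rL z M0 L0)
  (fun i C => @sample_noise_centered i C) G k (k%:R * eps) mG Gk keps0.
have -> : (M + L) ^+ 2 * k%:R / (k%:R * eps) ^+ 2 = (M + L) ^+ 2 / (k%:R * eps ^+ 2).
  by field; rewrite !gt_eqF ?ltr0n.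
have E w : \sum_(i < n)
      (neighbour d (cross_table (fun i : 'I_n => X_ i w) x) k i)%:R *
      noise r M D (X_ i w, Y_ i w) =
    \sum_(i < n) \1_(G i) [tuple X_ l w | l < n] *
      noise r M D (pair_of (X_ i) (Y_ i) w).
  apply: eq_bigr => i _; congr (_ * _); rewrite indicE; congr (_%:R).
  have -> : cross_table (fun i : 'I_n => X_ i w) x =
      cross_table (tnth [tuple X_ l w | l < n]) x.
    by congr cross_table; apply/funext => j; rewrite tnth_mktuple.
  by congr nat_of_bool; apply/idP/idP; rewrite inE.
by congr (P _ <= _)%E; apply/seteqP; split => w /=; rewrite E.
Qed.

End at_point.

End regression.

(** The error is the average over the neighbours of the noise plus that of
   r (pts i) - r x; the truncation of the noise is inactive. *)
Lemma nn_estimate_close n k (pts : 'I_n -> 'rV[R]_d) (y : 'I_n -> R)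
    (r : 'rV[R]_d -> R) (x : 'rV[R]_d) (D : set 'rV[R]_d) (M eps : R) :
  general_position pts x -> (0 < k <= n)%N -> (forall i, `|y i| <= M) ->
  (forall i, neighbour d (cross_table pts x) k i -> D (pts i)) ->
  (forall z, D z -> `|r z - r x| <= eps) ->
  `|\sum_(i < n) (neighbour d (cross_table pts x) k i)%:R *
      noise r M D (pts i, y i)| <= k%:R * eps ->
  `|nn_estimate k pts y x - r x| <= 2 * eps.
Proof.
move=> gp /andP[k0 kn] yM nbD rD noiseS.
set nb := neighbour d (cross_table pts x) k in nbD noiseS *.
have k0' : 0 < k%:R :> R by rewrite ltr0n.
have nbE (f : 'I_n -> R) :
    \sum_(i <- take k (nn_order pts x)) f i = \sum_(i | nb i) f i.
  by rewrite nn_orderE// big_uniq// take_uniq// table_order_uniq.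
have nbk : \sum_(i | nb i) 1 = k%:R :> R.
  rewrite sumr_const; congr (_ *+ _).
  have -> : #|nb| = #|take k (table_order d (cross_table pts x))| by exact: eq_card.
  rewrite (card_uniqP _) ?take_uniq ?table_order_uniq// size_takel//.
  by rewrite size_sort size_enum_ord.
have -> : nn_estimate k pts y x - r x = k%:R^-1 *
    (\sum_(i | nb i) (y i - r (pts i)) + \sum_(i | nb i) (r (pts i) - r x)).
  rewrite /nn_estimate nbE -big_split/= -[X in _ - X](mulKf (lt0r_neq0 k0')).
  rewrite -mulrBr; congr (_ * _); rewrite -nbk mulr_suml -sumrB.
  by apply: eq_bigr => i _; ring.
have noiseE : \sum_(i | nb i) (y i - r (pts i)) =
    \sum_i (nb i)%:R * noise r M D (pts i, y i).
  rewrite big_mkcond; apply: eq_bigr => i _; case: ifP => nbi; last by rewrite mul0r.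
  have Di : pts i \in D by rewrite inE; exact: nbD.
  have yi : y i \in [set z : R | `|z| <= M] by rewrite inE; exact: yM.
  by rewrite /noise !indicE/= Di yi !mul1r.
rewrite noiseE normrM gtr0_norm ?invr_gt0// ler_pdivrMl//.
rewrite (le_trans (ler_normD _ _))// mulrCA mulr2n mulrDl mul1r lerD//.
rewrite (le_trans (ler_norm_sum _ _ _))// -nbk mulr_suml.
by apply: ler_sum => i nbi; rewrite mul1r; apply: rD; exact: nbD.
Qed.
(** * Consistency *)

(** Around a charged point simplices of sample points appear at every scale; a
   boundary point of a convex support is not charged. *)
Definition charged (x : 'rV[R]_d) :=
  forall l m, P (X @^-1` [set y | facing_cone d_gt0 m.+1%:R^-1 l (y - x)]) <> 0%E.

Lemma ae_charged : {ae distribution P X, forall x, charged x}.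
Proof.
pose A m (l : 'I_d.+1) := [set x | distribution P X
  [set y | facing_cone d_gt0 m.+1%:R^-1 l (y - x)] = 0%E].
have nA m l : (distribution P X).-negligible (A m l).
  apply: (ae_mass_along_direction (mu := [the probability _ _ of distribution P X])
    (e := axis R l) (delta := m.+1%:R^-1)) => //.
  - exact: density_absolutely_continuous.
  - exact: measurable_cone.
  - apply: cone_axis.
    + exact: axis_coord_unit.
    + exact: axis_le1.
    + exact: aperture_gt0.
    + by have := @aperture_le R d d_gt0; lra.
apply: (negligibleS _ (negligible_bigcup (fun m => negligible_fin_exists (nA m)))).
move=> x /= /existsNP[l /existsNP[m /contrapT xlm]].
by exists m => //; exists l.
Qed.

Let box (x : 'rV[R]_d) (e : R) := [set y : 'rV[R]_d | forall m, `|(y - x) ord0 m| <= e].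

Let measurable_box x e : measurable (box x e).
Proof.
apply: measurable_fin_forall => m; apply: measurable_set_le.
  apply: measurableT_comp => //.
  by apply: (measurableT_comp (measurable_rV_coord m)); exact: measurable_rV_translate.
exact: measurable_cst.
Qed.

Let card_indic n (A : set 'rV[R]_d) w :
  (#|[set j : 'I_n | `[< A (X_ j w) >] ]%SET|%:R : R) =
  \sum_(j < n) \1_(X_ j @^-1` A) w.
Proof.
rewrite -sum1_card natr_sum big_mkcond/=; apply: eq_bigr => j _.
rewrite inE indicE; have [Aj|Aj] := pselect (A (X_ j w)).
  by rewrite (asboolT Aj) mem_set.
by rewrite (asboolF Aj) memNset.
Qed.

Let sample_mass_gt0 A : measurable A -> P (X @^-1` A) <> 0%E ->
  exists2 b : R, 0 < b & P (X @^-1` A) = b%:E.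
Proof.
move=> mA A0; exists (fine (P (X @^-1` A))).
  rewrite fine_gt0// lt0e measure_ge0 (introN eqP A0)/= -ge0_fin_numE//.
  by rewrite fin_num_measure//; exact: measurable_preimage_fun.
by rewrite fineK// fin_num_measure//; exact: measurable_preimage_fun.
Qed.

Section at_good_point.
Context (M : R) (M0 : 0 <= M) (YM : {ae P, forall w, `|Y w| <= M}).
Context (r : 'rV[R]_d -> R) (hr : regression_function X Y r).
Context (x : 'rV[R]_d) (r_cont : {for x, continuous r}) (x_charged : charged x).

Definition estimation_error n k w : R :=
  `|nn_estimate k (fun i : 'I_n => X_ i w) (fun i : 'I_n => Y_ i w) x - r x|.

Lemma estimation_error_bounded n k w :
  (forall i : 'I_n, `|Y_ i w| <= M) -> estimation_error n k w <= M + `|r x|.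
Proof.
move=> YwM; rewrite /estimation_error (le_trans (ler_normB _ _))// lerD2r /nn_estimate.
have [->|k0] := posnP k; first by rewrite invr0 mul0r normr0.
have k0' : 0 < k%:R :> R by rewrite ltr0n.
rewrite normrM gtr0_norm ?invr_gt0// ler_pdivrMl//.
rewrite (le_trans (ler_norm_sum _ _ _))//.
apply: (@le_trans _ _ (\sum_(i <- take k (nn_order (fun i : 'I_n => X_ i w) x)) M)).
  by apply: ler_sum => i _.
rewrite big_const_seq count_predT iter_addr addr0 -[leLHS]mulr_natl ler_wpM2r//.
by rewrite ler_nat size_take_min geq_minl.
Qed.

(** The heart of the argument: the exceptional event is split into the failure
   of the law of large numbers in the cones and in a small box around x, too
   many steep facets, and a large average noise. *)
Lemma error_small_with_high_probability (eps beta : R) (k : nat -> nat) :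
  0 < eps -> 0 < beta ->
  k n @[n --> \oo] --> \oo ->
  ((k n)%:R / n%:R : R) @[n --> \oo] --> (0 : R) ->
  \forall n \near \oo, exists B N : set Omega,
    [/\ measurable B, (P B <= beta%:E)%E, P.-negligible N,
      (forall w, ~ N w -> forall i : 'I_n, `|Y_ i w| <= M) &
      (forall w, ~ N w -> ~ B w -> estimation_error n (k n) w <= 2 * eps)].
Proof.
move=> eps0 beta0 koo kn0.
have [rho rho0 rhoP] : exists2 rho : R, 0 < rho & forall y,
    (forall m, `|(y - x) ord0 m| < rho) -> `|r y - r x| <= eps.
  move/cvgrPdist_le : r_cont => /(_ eps eps0) /nbhs_ballP[rho /= rho0 rhoP].
  exists rho => // y yx; rewrite distrC; apply: rhoP; split => // i m.
  by rewrite (ord1 i) /ball/= distrC; have := yx m; rewrite !mxE.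
pose m0 := Num.trunc (2 / rho).
pose delta : R := m0.+1%:R^-1.
have delta0 : 0 < delta by rewrite invr_gt0.
have delta_rho : 2 * delta < rho.
  by rewrite ltr_pdivrMr// mulrC -ltr_pdivrMr// truncnS_gt.
pose D := box x (2 * delta).
have mD : measurable D by exact: measurable_box.
have rD y : D y -> `|r y - r x| <= eps.
  by move=> Dy; apply: rhoP => m; apply: le_lt_trans delta_rho; exact: Dy.
pose L := `|r x| + eps.
have L0 : 0 <= L by rewrite addr_ge0// ltW.
have rL y : D y -> `|r y| <= L.
  move=> /rD; have := ler_normD (r y - r x) (r x); rewrite subrK /L; lra.
pose C l := [set y | facing_cone d_gt0 delta l (y - x)].
have mC l : measurable (C l).
  apply: measurable_preimage_fun (measurable_rV_translate (- x)) _.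
  exact: measurable_cone.
have /all_sig2[b b0 bE] : forall l, {b : R | 0 < b & P (X @^-1` C l) = b%:E}.
  by move=> l; apply/cid2/sample_mass_gt0 => //; exact: x_charged.
(* with at least n b_l / 2 points in the cone l, far points are at empirical
   distance at least c n^d *)
pose c : R := \prod_l (b l / 2).
have c0 : 0 < c by apply: prodr_gt0 => l _; rewrite divr_gt0.
(* d + 1 cones, the box, the steep facets and the noise *)
pose beta' := beta / (d + 4)%:R.
have beta'0 : 0 < beta' by rewrite divr_gt0// ltr0n addn4.
have [m mP] : exists m : nat,
    (P [set w | (m.+1%:R <= steepness x (fun i => X_ i w))%R] <= (beta' * c)%:E)%E.
  apply: probability_tail_small; last exact: mulr_gt0.
  by apply: measurable_steepness => i; exact: measurable_funP.
pose eta : R := m.+1%:R^-1.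
have eta0 : 0 < eta by rewrite invr_gt0.
have [b' b'0 b'E] : exists2 b' : R, 0 < b' & P (X @^-1` box x eta) = b'%:E.
  apply: sample_mass_gt0 => // box0; apply: (@x_charged ord0 (m.*2.+1)).
  apply/eqP; rewrite -measure_le0 -box0; apply: le_measure; rewrite ?inE.
  - apply: measurable_preimage_fun => //.
    apply: measurable_preimage_fun (measurable_rV_translate (- x)) _.
    exact: measurable_cone.
  - exact: measurable_preimage_fun.
  - move=> w xw l; apply/ltW.
    have -> : eta = 2 * (m.*2.+2)%:R^-1.
      by rewrite /eta -doubleS -muln2 natrM invfM mulrCA divff ?mulr1.
    apply: cone_bounded xw; first exact: axis_le1.
    by have := @aperture_le R d d_gt0; lra.
(* n >= T and n >= T' make the law of large numbers effective in the cones and in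
   the box, k n >= K makes the average noise small *)
pose T := \sum_l 4 / (beta' * b l ^+ 2).
pose T' := 4 / (beta' * b' ^+ 2).
pose K := (M + L) ^+ 2 / (eps ^+ 2 * beta').
have T_ge l : 4 / (beta' * b l ^+ 2) <= T.
  rewrite /T (bigD1 l)//= lerDl sumr_ge0// => i _.
  by rewrite divr_ge0// mulr_ge0// ?ltW// exprn_gt0.
have lln_rate (n : nat) (a : R) : (0 < n)%N -> 0 < a -> 4 / (beta' * a ^+ 2) <= n%:R ->
    4 / (n%:R * a ^+ 2) <= beta'.
  move=> n0 a0; have n0' : 0 < n%:R :> R by rewrite ltr0n.
  rewrite ler_pdivrMr ?mulr_gt0 ?exprn_gt0// => h.
  by rewrite ler_pdivrMr ?mulr_gt0 ?exprn_gt0//; nra.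
have near_n0 : \forall n \near \oo, (0 < n)%N by exact: nbhs_infty_gt.
have near_T : \forall n \near \oo, T <= n%:R by exact: nbhs_infty_ger.
have near_T' : \forall n \near \oo, T' <= n%:R by exact: nbhs_infty_ger.
have near_K : \forall n \near \oo, (Num.trunc K < k n)%N.
  by move/cvgnyPgt : koo => /(_ (Num.trunc K)).
have near_kn : \forall n \near \oo, (k n)%:R / n%:R <= Num.min (b' / 2) 1.
  have min0 : 0 < Num.min (b' / 2) 1 by rewrite lt_min ltr01 divr_gt0.
  move/cvgrPdist_le : kn0 => /(_ _ min0); apply: filterS => n.
  by rewrite sub0r normrN ger0_norm// divr_ge0.
near=> n.
have n0 : (0 < n)%N by near: n.
have n0' : 0 < n%:R :> R by rewrite ltr0n.
have nT : T <= n%:R by near: n.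
have nT' : T' <= n%:R by near: n.
have kK : (Num.trunc K < k n)%N by near: n.
have k0 : (0 < k n)%N by apply: leq_ltn_trans kK.
have : (k n)%:R / n%:R <= Num.min (b' / 2) 1 by near: n.
rewrite le_min !ler_pdivrMr// mul1r ler_nat => /andP[kb' kn].
pose pts w (i : 'I_n) := X_ i w.
pose B1 := [set w | exists l : 'I_d.+1,
  \sum_(i < n) \1_(X_ i @^-1` C l) w <= n%:R * b l / 2].
pose B2 := [set w | \sum_(i < n) \1_(X_ i @^-1` box x eta) w <= n%:R * b' / 2].
pose B3 := [set w | c * n%:R ^+ d <=
  \sum_(S : {set 'I_n} | #|S| == d) \1_(steep_facet x m.+1%:R S) w].
pose B4 := [set w | (k n)%:R * eps <= `|\sum_(i < n)
  (neighbour d (cross_table (pts w) x) (k n) i)%:R * noise r M D (X_ i w, Y_ i w)|].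
have mindX (A : set 'rV[R]_d) : measurable A ->
    measurable_fun setT (fun w => \sum_(i < n) (\1_(X_ i @^-1` A) w : R)).
  by move=> mA; apply: measurable_sum => i; apply: measurable_indic;
    exact: measurable_preimage_fun.
have mB1' l : measurable [set w | \sum_(i < n) \1_(X_ i @^-1` C l) w <= n%:R * b l / 2].
  by apply: measurable_set_le; [exact: mindX|exact: measurable_cst].
have mB1 : measurable B1 by exact: measurable_fin_exists.
have mB2 : measurable B2.
  by apply: measurable_set_le; [exact: mindX|exact: measurable_cst].
have mB3 : measurable B3.
  apply: measurable_set_le; first exact: measurable_cst.
  by apply: measurable_event_count => S; exact: measurable_steep_facet.
have mB4 : measurable B4.
  apply: measurable_set_le; first exact: measurable_cst.
  apply: measurableT_comp => //; apply: measurable_sum => i; apply: measurable_funM.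
    have mnb : measurable [set w | neighbour d (cross_table (pts w) x) (k n) i].
      by apply: measurable_neighbour => j; exact: measurable_funP.
    rewrite (_ : (fun _ => _) =
        \1_[set w | neighbour d (cross_table (pts w) x) (k n) i]).
      exact: measurable_indic.
    apply/funext => w; rewrite indicE; congr (_%:R); congr nat_of_bool.
    by apply/idP/idP; rewrite inE.
  apply: (measurableT_comp (measurable_noise hr M mD)).
  by apply/measurable_fun_pairP; split; exact: measurable_funP.
have PB1 : (P B1 <= ((d.+1)%:R * beta')%:E)%E.
  apply: (le_trans (probability_fin_exists_le P mB1')).
  have -> : ((d.+1)%:R * beta')%:E = (\sum_(l < d.+1) beta'%:E)%E.
    by rewrite sumEFin sumr_const card_ord mulr_natl.
  apply: lee_sum => l _; apply: le_trans (few_sample_points n0 (mC l) (bE l) (b0 l)) _.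
  by rewrite lee_fin; apply: lln_rate => //; apply: le_trans nT.
have PB2 : (P B2 <= beta'%:E)%E.
  apply: le_trans (few_sample_points n0 (measurable_box x eta) b'E b'0) _.
  by rewrite lee_fin; apply: lln_rate.
have PB3 : (P B3 <= beta'%:E)%E.
  have cn0 : 0 < c * n%:R ^+ d by rewrite mulr_gt0// exprn_gt0.
  apply: (le_trans (markov_count (q := beta' * c) _ _ cn0)).
  - by move=> S; exact: measurable_steep_facet.
  - by move=> S /eqP Sd; rewrite steep_facet_law.
  have draws : #|[pred S : {set 'I_n} | #|S| == d]|%:R <= n%:R ^+ d :> R.
    by rewrite -natrX ler_nat card_draws_le.
  rewrite lee_fin ler_pdivrMr//.
  have := ler_wpM2r (mulr_ge0 (ltW beta'0) (ltW c0)) draws; congr (_ <= _).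
  by rewrite mulrC mulrA.
have PB4 : (P B4 <= beta'%:E)%E.
  apply: le_trans (neighbour_noise_small M0 YM hr x mD L0 rL n k0 eps0) _.
  rewrite lee_fin ler_pdivrMr ?mulr_gt0 ?ltr0n ?exprn_gt0//.
  have : K <= (k n)%:R by apply/ltW/(lt_le_trans (truncnS_gt K)); rewrite ler_nat.
  rewrite /K ler_pdivrMr ?mulr_gt0 ?exprn_gt0// => /le_trans; apply.
  by rewrite le_eqVlt; apply/orP; left; apply/eqP; ring.
pose Npos := [set w | ~ general_position (pts w) x].
pose NY := [set w | exists i : 'I_n, ~ `|Y_ i w| <= M].
exists (B1 `|` B2 `|` (B3 `|` B4)), (Npos `|` NY); split.
- by apply: measurableU; apply: measurableU.
- apply: (le_trans (measureU2 _ _ _)); [exact: measurableU|exact: measurableU|].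
  have h12 := measureU2 P mB1 mB2; have h34 := measureU2 P mB3 mB4.
  apply: (le_trans (leeD (le_trans h12 (leeD PB1 PB2)) (le_trans h34 (leeD PB3 PB4)))).
  rewrite -!EFinD lee_fin.
  have -> : beta = (d + 4)%:R * beta' by rewrite mulrC divfK// pnatr_eq0 addn4.
  by rewrite natrD -[d.+1]addn1 natrD; lra.
- apply: negligibleU; first exact: sample_general_position.
  apply: (negligible_fin_exists (A := fun i : 'I_n => [set w | ~ `|Y_ i w| <= M])).
  by move=> i; exact: (sample_bounded YM).
- by move=> w /not_orP[_ /forallNP nY] i; exact: (contrapT (nY i)).
move=> w /not_orP[/contrapT gp /forallNP nY] nB.
have [nB1 nB2 nB3 nB4] : [/\ ~ B1 w, ~ B2 w, ~ B3 w & ~ B4 w].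
  by split => h; apply: nB; [left; left|left; right|right; left|right; right].
have near_x i : neighbour d (cross_table (pts w) x) (k n) i -> D (pts w i).
  apply: (neighbours_are_close (eta := eta)) gp eta0 _ _.
    rewrite -(ler_nat R) (card_indic n (box x eta)).
    move: nB2; rewrite /B2/= => /negP; rewrite -ltNge => /ltW; apply: le_trans.
    by move: kb'; rewrite [_ / 2 * _]mulrC mulrA.
  rewrite -(ltr_nat R) natrM natr_sum.
  apply: (@lt_le_trans _ _ (n%:R * (c * n%:R ^+ d))).
    rewrite ltr_pM2l//; move: nB3; rewrite /B3/= => /negP; rewrite -ltNge.
    apply: le_lt_trans; rewrite le_eqVlt; apply/orP; left; apply/eqP.
    apply: eq_bigr => S _; rewrite indicE invrK; congr (_%:R); congr nat_of_bool.
    by apply/idP/idP; rewrite inE.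
  rewrite natr_prod mulrCA -exprS.
  have -> : c * n%:R ^+ d.+1 = \prod_(l < d.+1) (n%:R * b l / 2).
    rewrite /c -[X in _ ^+ X](card_ord d.+1) -prodr_const -big_split/=.
    by apply: eq_bigr => l _; rewrite mulrC mulrA.
  apply: ler_prod => l _; rewrite (card_indic n (C l)).
  apply/andP; split; first by rewrite divr_ge0// mulr_ge0// ltW.
  by apply/ltW; rewrite ltNge; apply/negP => h; apply: nB1; exists l.
apply: (nn_estimate_close (D := D) (M := M)) => //.
- by rewrite k0 kn.
- by move=> i; exact: (contrapT (nY i)).
- by apply/ltW; rewrite ltNge; apply/negP.
Unshelve. all: by end_near. Qed.

End at_good_point.

End sample.

Lemma cvge_to0 (R : realType) (u : nat -> \bar R) :
  (forall n, 0 <= u n)%E ->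
  (forall e : R, 0 < e -> \forall n \near \oo, (u n <= e%:E)%E) ->
  u n @[n --> \oo] --> 0%E.
Proof.
move=> u0 usmall; apply/fine_cvgP; split.
  apply: filterS (usmall 1 ltr01) => n un1.
  by rewrite ge0_fin_numE//; apply: le_lt_trans un1 _; exact: ltry.
apply/cvgrPdist_le => e e0; apply: filterS (usmall e e0) => n une /=.
rewrite sub0r normrN ger0_norm ?fine_ge0//.
rewrite -lee_fin fineK// ge0_fin_numE//.
by apply: le_lt_trans une _; exact: ltry.
Qed.

(* The sample is indexed from 0: (X_ 0, Y_ 0), ..., (X_ n.-1, Y_ n.-1). *)
Theorem theorem2p1 (R : realType) (d : nat) (hd : (0 < d)%N)
    (disp : measure_display) (Omega : measurableType disp)
    (P : probability Omega R)
    (X : {RV P >-> 'rV[R]_d}) (Y : {RV P >-> R})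
    (X_ : nat -> {RV P >-> 'rV[R]_d}) (Y_ : nat -> {RV P >-> R})
    (hdist : forall i, identically_distributed P
       (fun w => (X_ i w, Y_ i w)) (fun w => (X w, Y w)))
    (hindep : mutually_independent P
       (fun (o : option nat) w =>
          if o is Some i then (X_ i w, Y_ i w) else (X w, Y w)))
    (hdens : has_density X)
    (hY : exists M : R, {ae P, forall w, `|Y w| <= M})
    (r : 'rV[R]_d -> R) (hr : regression_function X Y r)
    (hcont : {ae distribution P X, forall x, {for x, continuous r}})
    (k : nat -> nat) (hk : forall n, (d <= n)%N -> (1 <= k n <= n)%N) :
  {ae distribution P X, forall x, forall p : R, 1 <= p ->
    k n @[n --> \oo] --> \oo ->
    ((k n)%:R / n%:R : R) @[n --> \oo] --> (0 : R) ->
    ('E_P[fun w => (`|nn_estimate (k n) (fun i : 'I_n => X_ i w)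
                      (fun i : 'I_n => Y_ i w) x - r x| `^ p)%R])%E
      @[n --> \oo] --> 0%E}.

Proof.
have [M0' YM0'] := hY; pose M := `|M0'|.
have YM : {ae P, forall w, `|Y w| <= M}.
  by apply: filterS YM0' => w /le_trans; apply; exact: ler_norm.
apply: filterS2 hcont (ae_charged hd hdens) => x rx xC p p1 koo kn0.
have p0 : 0 < p by apply: lt_le_trans p1.
apply: cvge_to0 => [n|e e0].
  by rewrite unlock; apply: integral_ge0 => w _; rewrite lee_fin powR_ge0.
pose a : R := (e / 2) `^ p^-1.
have a0 : 0 < a by rewrite powR_gt0// divr_gt0.
have aE : a `^ p = e / 2.
  by rewrite /a -powRrM mulVf ?gt_eqF// powRr1// divr_ge0// ltW.
pose L : R := (M + `|r x|) `^ p.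
have L0 : 0 <= L by exact: powR_ge0.
pose beta : R := e / 2 / (L + 1).
have beta0 : 0 < beta by rewrite divr_gt0 ?divr_gt0// ltr_wpDl.
have Lbeta : L * beta <= e / 2.
  rewrite /beta mulrCA ler_piMr ?divr_ge0 ?(ltW e0)//.
  by rewrite ler_pdivrMr ?mul1r ?lerDl// ltr_wpDl.
have := error_small_with_high_probability hdist hindep hdens (normr_ge0 _) YM hr
  rx xC (divr_gt0 a0 (ltr0Sn R 1)) beta0 koo kn0.
apply: filterS => n [B [N [mB PB negN YwM small]]].
rewrite unlock; apply: le_trans (integral_le_exceptional (a := e / 2) (L := L)
  _ _ _ mB negN _ _) _.
- by move=> w; exact: powR_ge0.
- by rewrite divr_ge0// ltW.
- exact: L0.
- move=> w Nw Bw; rewrite -aE; apply: ge0_ler_powR; rewrite ?nnegrE//;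
    [exact: ltW|exact: ltW|].
  by apply: le_trans (small w Nw Bw) _; rewrite mulrC divfK.
- move=> w Nw; apply: ge0_ler_powR; rewrite ?nnegrE//;
    [exact: ltW|by rewrite addr_ge0 /M|].
  exact: estimation_error_bounded (YwM w Nw).
have : (L%:E * P B <= (e / 2)%:E)%E.
  apply: (@le_trans _ _ (L%:E * beta%:E)%E); first by apply: lee_wpmul2l.
  by rewrite -EFinM lee_fin.
move=> LB; apply: (@le_trans _ _ ((e / 2)%:E + (e / 2)%:E)%E).
  by rewrite leeD2l.
by rewrite -EFinD -splitr.
Qed.
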